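(* Let $u\in\mathcal{X}$ be the solution of the weak parabolic problem (P) and $u_\tau\in\mathcal{S}_\tau$ the solution of the discontinuous Galerkin problem (DG), both stated in the context. Then $$\|u-u_\tau\|_{\mathcal{X},\tau}\le\left(1+\frac{M_1}{c_1}\right)\inf_{w_\tau\in\mathcal{S}_\tau}\|u-w_\tau\|_{\mathcal{X},\tau,\star},$$ $$|\!|\!|u-u_\tau|\!|\!|_{\mathcal{Y},\tau,\#}\le\left(1+\frac{M_2}{c_2}\right)\inf_{w_\tau\in\mathcal{S}_\tau}|\!|\!|u-w_\tau|\!|\!|_{\mathcal{Y},\tau},$$ where $c_1,c_2>0$ (depending only on $\alpha,M,q$) and $M_1,M_2>0$ (depending only on $M$) are the inf-sup and boundedness constants of $B_\tau$ described in the context.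
   Context: Let $H$ and $V$ be real Hilbert spaces with $V\subset H$ dense and the injection continuous. Norms are $\|\cdot\|_V$ and $\|\cdot\|=\|\cdot\|_H$; $(\cdot,\cdot)$ is the inner product of $H$. Identify $H$ with its dual $H'$, so that $V\subset H\subset V'$, and let $\langle\cdot,\cdot\rangle$ be the duality pairing between $V'$ and $V$. Let $T>0$, $J=(0,T)$. For a.e. $t\in J$ a linear operator $A(t):V\to V'$ is given, and there are positive constants $M,\alpha$ independent of $t$ such that for a.e. $t\in J$: $|\langle A(t)w,v\rangle|\le M\|w\|_V\|v\|_V$ for all $w,v\in V$, and $\langle A(t)v,v\rangle\ge\alpha\|v\|_V^2$ for all $v\in V$. Let $\mathcal{X}=L^2(J;V)\cap H^1(J;V')$ (continuously embedded in $C^0(\overline J;H)$). Given $F\in L^2(J;V')$ and $u_0\in H$, problem (P) is: find $u\in\mathcal{X}$ with $$\int_J[\langle u',v_1\rangle+\langle A(t)u,v_1\rangle]dt+(u(0),v_2)=\int_J\langle F,v_1\rangle dt+(u_0,v_2)\quad\forall (v_1,v_2)\in L^2(J;V)\times H.$$ Partition: $0=t_0<t_1<\cdots<t_N=T$, $J_n=(t_n,t_{n+1}]$, $\tau_n=t_{n+1}-t_n$ ($0\le n\le N-1$), $\tau=\max_n\tau_n$, and it is assumed that $\tau\le1$. For an integer $q\ge0$, $\mathcal{S}_\tau$ is the set of functions $v$ on $(0,T]$ such that for each $n$ the restriction $v|_{J_n}$ is a $V$-valued polynomial in $t$ of degree $\le q$. Write $v^{n,+}=\lim_{t\downarrow t_n}v(t)$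 and $v^{n+1}=v(t_{n+1})$ for $n=0,\dots,N-1$. Derivatives are taken on each $J_n$. Set $$B_\tau(w,v)=\sum_{n=0}^{N-1}\int_{J_n}\left[(w',v)+\langle A(t)w,v\rangle\right]dt+(w^{0,+},v^{0,+})+\sum_{n=1}^{N-1}(w^{n,+}-w^n,v^{n,+}).$$ Problem (DG): find $u_\tau\in\mathcal{S}_\tau$ with $B_\tau(u_\tau,v_\tau)=\int_J\langle F,v_\tau\rangle dt+(u_0,v_\tau^{0,+})$ for all $v_\tau\in\mathcal{S}_\tau$. Norms (for $v\in\mathcal{S}_\tau$, and by the same formulas for differences $v=u-w_\tau$ with $w_\tau\in\mathcal{S}_\tau$): $\|v\|_{\mathcal{X},\tau}^2=\sum_{n=0}^{N-1}\int_{J_n}[\|v'\|_{V'}^2+\|v\|_V^2]dt+\|v^{0,+}\|^2+\sum_{n=1}^{N-1}\|v^{n,+}-v^n\|^2$; $\|v\|_{\mathcal{X},\tau,\star}^2$ is the same with the last sum replaced by $\sum_{n=1}^{N-1}\tau_n^{-1}\|v^{n,+}-v^n\|^2$; $\|v\|_{\mathcal{Y},\tau,\#}^2=\sum_{n=0}^{N-1}\int_{J_n}\|v\|_V^2dt+\|v^{0,+}\|^2+\sum_{n=1}^{N-1}\tau_n\|v^{n,+}\|^2$; $|\!|\!|v|\!|\!|_{\mathcal{X},\tau}^2=\sum_{n=0}^{N-1}\int_{J_n}[\|v'\|_{V'}^2+\|v\|_V^2]dt+\|v^N\|^2+\sum_{n=1}^{N-1}\|v^{n,+}-v^n\|^2$;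 $|\!|\!|v|\!|\!|_{\mathcal{Y},\tau}^2=\sum_{n=0}^{N-1}\int_{J_n}\|v\|_V^2dt+\|v^N\|^2+\sum_{n=1}^{N-1}\|v^{n,+}\|^2$; $|\!|\!|v|\!|\!|_{\mathcal{Y},\tau,\#}^2$ is the same as $|\!|\!|v|\!|\!|_{\mathcal{Y},\tau}^2$ with the last sum replaced by $\sum_{n=1}^{N-1}\tau_n\|v^{n,+}\|^2$. Constants: $c_1,c_2$ are the positive constants, depending only on $\alpha,M,q$, with $$\inf_{w\in\mathcal{S}_\tau}\sup_{v\in\mathcal{S}_\tau}\frac{B_\tau(w,v)}{\|w\|_{\mathcal{X},\tau}\|v\|_{\mathcal{Y},\tau,\#}}= c_1,\qquad \inf_{w\in\mathcal{S}_\tau}\sup_{v\in\mathcal{S}_\tau}\frac{B_\tau(w,v)}{|\!|\!|w|\!|\!|_{\mathcal{Y},\tau,\#}|\!|\!|v|\!|\!|_{\mathcal{X},\tau}}= c_2$$ (infima and suprema over nonzero elements), and $M_1,M_2$ are the positive constants, depending only on $M$, in the bounds $|B_\tau(w,v)|\le M_1\|w\|_{\mathcal{X},\tau,\star}\|v\|_{\mathcal{Y},\tau,\#}$ and $|B_\tau(w,v)|\le M_2|\!|\!|w|\!|\!|_{\mathcal{Y},\tau}|\!|\!|v|\!|\!|_{\mathcal{X},\tau}$ for $w,v\in\mathcal{S}_\tau$.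
   Formalization: The bounds with M_1, M_2 are assumed also for the differences u-w_τ, not only on S_τ: an M_2 depending only on M does not exist for the given norm, and with M_2 taken on S_τ alone the second estimate fails. c_1, c_2 may be any positive lower bounds of the inf-sup values. *)

(* Defs.v *)
From HB Require Import structures.
From mathcomp Require Import all_boot all_order all_algebra.
From mathcomp Require Import all_classical all_reals all_analysis.

Set Implicit Arguments.
Unset Strict Implicit.
Unset Printing Implicit Defensive.

Import Order.TTheory GRing.Theory Num.Theory.
Import numFieldNormedType.Exports.

Local Open Scope classical_set_scope.
Local Open Scope ring_scope.

(* A real Hilbert space is a complete normed space with a dot product [ip]
   inducing its norm. *)
Definition hilbert (R : realType) (E : completeNormedModType R)
    (ip : {dot E for (@idfun R)}) : Prop :=
  forall x : E, `|x| ^+ 2 = ip x x.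

Definition dense_injection (R : realType) (V H : completeNormedModType R)
    (iota : {linear V -> H}) : Prop :=
  [/\ injective iota, continuous iota & dense (range iota)].

Section Dual.
Context {R : realType} {V : completeNormedModType R}.

Definition dual : set (V -> R) :=
  [set f | scalar f /\ exists C : R, forall x, `|f x| <= C * `|x|].

Definition dual_norm (f : V -> R) : R :=
  sup [set `|f x| | x in [set x : V | `|x| <= 1]].

End Dual.

(* [S] with [nrm] is the normed space in which the functions take their values:
   [setT] with the norm for V, [dual] with [dual_norm] for V'. *)
Section BochnerL2.
Context {R : realType} {E : zmodType}.
Variables (S : set E) (nrm : E -> R) (D : set R).

Definition simple_fun (s : R -> E) : Prop :=
  [/\ finite_set (range s), range s `<=` S
    & forall x : E, measurable (s @^-1` [set x])].

(* Functions stand for their a.e. classes; the representative is chosen so that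
   the approximating simple functions converge everywhere on [D]. *)
Definition strongly_measurable (f : R -> E) : Prop :=
  (forall t, D t -> S (f t)) /\
  exists2 s : nat -> R -> E, (forall k, simple_fun (s k))
    & forall t, D t -> (fun k => nrm (f t - s k t)) @ \oo --> (0 : R).

Definition bochner_L2 (f : R -> E) : Prop :=
  strongly_measurable f /\
  (\int[lebesgue_measure]_(t in D) (nrm (f t) ^+ 2)%:E < +oo)%E.

End BochnerL2.

Definition L2V (R : realType) (V : completeNormedModType R) (D : set R)
    (f : R -> V) : Prop :=
  bochner_L2 setT (fun x : V => `|x|) D f.

Definition L2V' (R : realType) (V : completeNormedModType R) (D : set R)
    (f : R -> V -> R) : Prop :=
  bochner_L2 (dual : set (V -> R)) dual_norm D f.

Definition test_function (R : realType) (T : R) (phi : R -> R) : Prop :=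
  (forall k t, derivable (derive1n k phi) t 1) /\
  exists a b : R, [/\ 0 < a, b < T & forall t, ~~ (a <= t <= b) -> phi t = 0].

(* A function on (0, T], with smoothness possibly broken at the nodes, seen
   through the triple V c H c V':
   [valV] is the V-valued function (for elements of the space X, up to a.e.
   equality), [valH] the H-valued representative from which traces are taken,
   and [der] the V'-valued (broken) time derivative. *)
Record bfun (R : realType) (V H : completeNormedModType R) := BFun {
  valV : R -> V;
  valH : R -> H;
  der : R -> V -> R }.

Definition bfun_sub (R : realType) (V H : completeNormedModType R)
    (w v : bfun V H) : bfun V H :=
  BFun (fun s => valV w s - valV v s)
       (fun s => valH w s - valH v s)
       (fun s x => der w s x - der v s x).

Section Spaces.
Context {R : realType} {V H : completeNormedModType R}.
Variables (ipH : {dot H for (@idfun R)}) (iota : {linear V -> H}).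

(* The identity [\int u phi' = - \int g phi] in V', evaluated at each [x : V];
   H is identified with its dual, so that h in H acts on V as
   [x |-> ipH h (iota x)]. *)
Definition weak_derivative (T : R) (u : R -> V) (g : R -> V -> R) : Prop :=
  forall (phi : R -> R) (x : V), test_function T phi ->
    \int[lebesgue_measure]_(s in `]0, T[) (ipH (iota (u s)) (iota x) * derive1 phi s)
    = - \int[lebesgue_measure]_(s in `]0, T[) (g s x * phi s).

(* L^2(J; V) `&` H^1(J; V'), with the representative in C^0([0, T]; H). *)
Definition Xspace (T : R) : set (bfun V H) :=
  [set u | [/\ L2V `]0, T[ (valV u),
               L2V' `]0, T[ (der u),
               weak_derivative T (valV u) (der u),
               {within `[0, T], continuous (valH u)}
             & {ae lebesgue_measure, forall s,
                 `]0, T[%classic s -> iota (valV u s) = valH u s}]].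

Definition bfun_of (w : R -> V) : bfun V H :=
  BFun w (fun s => iota (w s)) (fun s x => ipH (iota (derive1 w s)) (iota x)).

Definition time_partition (T : R) (N : nat) (t : nat -> R) : Prop :=
  [/\ t 0%N = 0, t N = T & forall n, (n < N)%N -> t n < t n.+1].

Definition step (t : nat -> R) (n : nat) : R := t n.+1 - t n.

Definition mesh (N : nat) (t : nat -> R) : R :=
  \big[Num.max/0]_(n < N) step t n.

Definition Jn (t : nat -> R) (n : nat) : set R := [set` `]t n, t n.+1]].

Definition piecewise_poly (q N : nat) (t : nat -> R) (w : R -> V) : Prop :=
  forall n, (n < N)%N -> exists a : 'I_q.+1 -> V,
    forall s, Jn t n s -> w s = \sum_(i < q.+1) s ^+ i *: a i.

Definition Stau (q N : nat) (t : nat -> R) : set (bfun V H) :=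
  [set bfun_of w | w in piecewise_poly q N t].

(* Elements of [Stau] are functions on (0, T]; their values elsewhere are
   irrelevant. *)
Definition Stau_nonzero (T : R) (q N : nat) (t : nat -> R) : set (bfun V H) :=
  Stau q N t `&` [set w | exists2 s, 0 < s <= T & valV w s != 0].

End Spaces.

Section Norms.
Context {R : realType} {V H : completeNormedModType R}.
Variables (N : nat) (t : nat -> R).
Implicit Types v : bfun V H.

Definition rtrace v (n : nat) : H := lim (valH v s @[s --> (t n)^'+]).

Definition ltrace v (n : nat) : H := valH v (t n).

Definition jump v (n : nat) : H := rtrace v n - ltrace v n.

Definition L2V_part v : R :=
  \sum_(n < N) \int[lebesgue_measure]_(s in Jn t n) (`|valV v s| ^+ 2).

Definition energy_part v : R :=
  \sum_(n < N) \int[lebesgue_measure]_(s in Jn t n)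
    (dual_norm (der v s) ^+ 2 + `|valV v s| ^+ 2).

Definition norm_X v : R := Num.sqrt
  (energy_part v + `|rtrace v 0%N| ^+ 2 + \sum_(1 <= n < N) `|jump v n| ^+ 2).

Definition norm_Xstar v : R := Num.sqrt
  (energy_part v + `|rtrace v 0%N| ^+ 2
   + \sum_(1 <= n < N) (step t n)^-1 * `|jump v n| ^+ 2).

Definition norm_Ysharp v : R := Num.sqrt
  (L2V_part v + `|rtrace v 0%N| ^+ 2
   + \sum_(1 <= n < N) step t n * `|rtrace v n| ^+ 2).

Definition tnorm_X v : R := Num.sqrt
  (energy_part v + `|ltrace v N| ^+ 2 + \sum_(1 <= n < N) `|jump v n| ^+ 2).

Definition tnorm_Y v : R := Num.sqrt
  (L2V_part v + `|ltrace v N| ^+ 2 + \sum_(1 <= n < N) `|rtrace v n| ^+ 2).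

Definition tnorm_Ysharp v : R := Num.sqrt
  (L2V_part v + `|ltrace v N| ^+ 2
   + \sum_(1 <= n < N) step t n * `|rtrace v n| ^+ 2).

End Norms.

Section Problems.
Context {R : realType} {V H : completeNormedModType R}.
Variables (ipH : {dot H for (@idfun R)}) (iota : {linear V -> H}).
Variables (T : R) (A : R -> V -> V -> R).

(* [A s w v] is the pairing <A(s) w, v>. The measurability clause is what makes
   the time integrals of the pairing meaningful. *)
Definition admissible_operator (alpha M : R) : Prop :=
  [/\ 0 < alpha, 0 < M,
      forall w v : V, measurable_fun `]0, T[ (fun s => A s w v)
    & {ae lebesgue_measure, forall s, `]0, T[%classic s ->
        [/\ forall w, dual (A s w),
            forall a w w' v, A s (a *: w + w') v = a * A s w v + A s w' v,
            forall w v, `|A s w v| <= M * `|w| * `|v|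
          & forall v, alpha * `|v| ^+ 2 <= A s v v]}].

Definition solves_P (F : R -> V -> R) (u0 : H) (u : bfun V H) : Prop :=
  Xspace ipH iota T u /\
  forall (v1 : R -> V) (v2 : H), L2V `]0, T[ v1 ->
    \int[lebesgue_measure]_(s in `]0, T[)
       (der u s (v1 s) + A s (valV u s) (v1 s)) + ipH (valH u 0) v2
    = \int[lebesgue_measure]_(s in `]0, T[) F s (v1 s) + ipH u0 v2.

Variables (q N : nat) (t : nat -> R).

Definition Btau (w v : bfun V H) : R :=
  \sum_(n < N) \int[lebesgue_measure]_(s in Jn t n)
     (der w s (valV v s) + A s (valV w s) (valV v s))
  + ipH (rtrace t w 0%N) (rtrace t v 0%N)
  + \sum_(1 <= n < N) ipH (jump t w n) (rtrace t v n).

Definition solves_DG (F : R -> V -> R) (u0 : H) (utau : bfun V H) : Prop :=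
  Stau ipH iota q N t utau /\
  forall v, Stau ipH iota q N t v ->
    Btau utau v = \int[lebesgue_measure]_(s in `]0, T[) F s (valV v s)
                  + ipH u0 (rtrace t v 0%N).

Definition infsup (nw nv : bfun V H -> R) : \bar R :=
  ereal_inf [set ereal_sup [set (Btau w v / (nw w * nv v))%:E
                           | v in Stau_nonzero ipH iota T q N t]
            | w in Stau_nonzero ipH iota T q N t].

(* A constant depending only on alpha, M and q cannot equal the inf-sup value of
   every discretization; it is a positive lower bound for it, which includes the
   case of equality. *)
Definition infsup_constant (nw nv : bfun V H -> R) (c : R) : Prop :=
  0 < c /\ (c%:E <= infsup nw nv)%E.

Definition errors (u : bfun V H) : set (bfun V H) :=
  [set bfun_sub u w | w in Stau ipH iota q N t].

(* The constant has to be valid for the differences [u - w] and not only on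
   [Stau]: for fixed [q], the least constant on [Stau] need not bound the form
   on [u - w]. *)
Definition boundedness_constant (u : bfun V H) (nw nv : bfun V H -> R) (C : R)
    : Prop :=
  0 < C /\
  forall w v, (Stau ipH iota q N t `|` errors u) w -> Stau ipH iota q N t v ->
    `|Btau w v| <= C * nw w * nv v.

End Problems.

(* Main.v *)
Require Import Defs.
From HB Require Import structures.
From mathcomp Require Import all_boot all_order all_algebra.
From mathcomp Require Import all_classical all_reals all_analysis.
From mathcomp Require Import measurable_realfun.
From mathcomp Require Import ring lra.
Import Order.TTheory GRing.Theory Num.Theory.
Import numFieldNormedType.Exports.
Local Open Scope classical_set_scope.
Local Open Scope ring_scope.

(** Both estimates are instances of one argument ([quasi_optimal]): consistency
plus discrete stability. The solution [u] of the continuous problem has no jump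
at the interior nodes, so testing its weak equation with a discrete function
gives the discontinuous Galerkin equation; hence [B (u - utau) v = 0] for every
discrete [v] ([Btau_galerkin]). For an arbitrary discrete [w], the function
[z = w - utau] is discrete and satisfies [B z v = - B (u - w) v]. The inf-sup
constant [c] then controls [z] by the bound of the functional [B (u - w)], that
is by [K / c] times the stronger norm of [u - w] ([infsup_control]). The
estimate follows from the triangle inequality for [u - utau = (u - w) + z], and
from the steps being at most 1, which makes the norm on the left-hand side
smaller than the one on the right-hand side.

Three facts make this argument legitimate for the integrals at hand.

Additivity of [B] in its first argument ([BtauD]) requires integrable
integrands. Both [g s (v s)], for [g] in L2(V') and [v] in L2(V), and
[A s (w s) (v s)] are limits of their values on simple functions, and are
dominated by squares of norms ([pairing_integrable]).

The properties of [A s] hold only for almost every [s], and the integrals are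
taken with respect to Borel sets, so that [A s (w s) (v s)] may fail to be
measurable on a null set. As the integral is defined by suprema over simple
functions, it does not see null sets, whether the integrand is measurable or
not ([integral_eq_off_null]). It is therefore enough to work with functions
that have an integrable representative ([ae_integrable]).

The triangle inequality for the norms, which mix integrals and traces, is
obtained from [(a + b)^2 <= (1 + e) a^2 + (1 + 1/e) b^2] for all [e > 0].
Inequalities of this form can be added, scaled and integrated, and the choice
of [e] is made once, at the end ([young_sqrt]). *)

Set Implicit Arguments.
Unset Strict Implicit.
Unset Printing Implicit Defensive.

(** * Integrals and null sets *)

Section NullSets.
Context d (T : measurableType d) (R : realType) (mu : {measure set T -> \bar R}).
Import HBNNSimple.

(** The two simple functions are measurable and differ only on [N]. *)
Lemma sintegral_off_null (N : set T) (h : {nnsfun T >-> R})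
    (mN : measurable N) (mCN : measurable (~` N)) : mu N = 0%E ->
  sintegral mu h = sintegral mu (proj_nnsfun h mCN).
Proof.
move=> N0; rewrite -!integralT_nnsfun.
have mh (k : {nnsfun T >-> R}) : measurable_fun setT (EFin \o (k : T -> R)).
  exact/measurable_EFinP.
apply: ge0_ae_eq_integral => //.
- exact: mh.
- exact: mh.
- by move=> x _; rewrite lee_fin fun_ge0.
- by move=> x _; rewrite lee_fin fun_ge0.
exists N; split => // x /= /not_implyP[_ nhx]; apply: contrapT => Nx.
by apply: nhx; rewrite mindicE mem_set ?mulr1.
Qed.

(** A simple function below [f] becomes, once set to zero on [N], a simple function
below [g] with the same integral. *)
Lemma nnintegral_le_off_null (N : set T) (f g : T -> \bar R) :
  measurable N -> mu N = 0%E -> (forall x, 0 <= g x)%E ->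
  (forall x, ~ N x -> f x = g x) ->
  (ereal_sup [set sintegral mu (h : T -> R) |
      h in [set h : {nnsfun T >-> R} | forall x, (h x)%:E <= f x]] <=
  ereal_sup [set sintegral mu (h : T -> R) |
      h in [set h : {nnsfun T >-> R} | forall x, (h x)%:E <= g x]])%E.
Proof.
move=> mN N0 g0 fg; apply: ge_ereal_sup => _ [h hf <-].
have mCN := measurableC mN.
rewrite (sintegral_off_null h mN mCN N0).
apply: ereal_sup_ubound; exists (proj_nnsfun h mCN) => // x /=.
rewrite mindicE; case: (boolP (x \in ~` N)) => [/set_mem/fg <-|_].
  by rewrite mulr1; exact: hf.
by rewrite mulr0.
Qed.

Lemma integral_eq_off_null (N D D' : set T) (f g : T -> \bar R) :
  measurable N -> mu N = 0%E ->
  (forall x, ~ N x -> (f \_ D) x = (g \_ D') x) ->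
  (\int[mu]_(x in D) f x = \int[mu]_(x in D') g x)%E.
Proof.
move=> mN N0 fg; rewrite /integral; congr (_ - _)%E; apply/eqP; rewrite eq_le;
  apply/andP; split; apply: (nnintegral_le_off_null mN N0) => x // Nx;
  by rewrite ?funeposE ?funenegE ?fg.
Qed.

(** The domains are compared too, so that the same notion covers the addition or
the removal of the end points of an interval. *)
Definition eq_off_null (D D' : set T) (f g : T -> R) : Prop :=
  exists N, [/\ measurable N, mu N = 0%E &
    forall x, ~ N x -> (D x <-> D' x) /\ (D x -> f x = g x)].

Lemma Rintegral_off_null (D D' : set T) (f g : T -> R) :
  eq_off_null D D' f g ->
  Rintegral mu D f = Rintegral mu D' g.
Proof.
move=> [N [mN N0 fg]]; congr fine; apply: (integral_eq_off_null mN N0) => x Nx.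
have [DD' /= fgx] := fg _ Nx.
rewrite !patchE; case: (boolP (x \in D)) => [/set_mem Dx|/negP nDx].
  by rewrite fgx// mem_set//; apply/DD'.
by rewrite memNset// => D'x; apply: nDx; apply/mem_set/DD'.
Qed.

(** Integrability for the completion of [mu]: [f] itself may fail to be measurable,
which happens for integrands built from an operator defined almost everywhere. *)
Definition ae_integrable (D : set T) (f : T -> R) : Prop :=
  exists2 g, mu.-integrable D (EFin \o g) & eq_off_null D D f g.

Lemma integrable_ae (D : set T) f : mu.-integrable D (EFin \o f) -> ae_integrable D f.
Proof. by move=> fi; exists f => //; exists set0; split. Qed.

Lemma ae_integrableD (D : set T) f g : measurable D ->
  ae_integrable D f -> ae_integrable D g -> ae_integrable D (f \+ g).
Proof.
move=> mD [f' fi [N [mN N0 ff]]] [g' gi [N' [mN' N'0 gg]]].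
exists (f' \+ g'); first exact: eq_integrable (integrableD mD fi gi).
exists (N `|` N'); split.
- exact: measurableU.
- exact: null_set_setU.
- by move=> x /not_orP[/ff[_ e2] /gg[_ e4]]; split=> //= Dx; rewrite e2// e4.
Qed.

Lemma ae_RintegralD (D : set T) f g h : measurable D ->
  ae_integrable D f -> ae_integrable D g -> eq_off_null D D h (f \+ g) ->
  Rintegral mu D h = Rintegral mu D f + Rintegral mu D g.
Proof.
move=> mD [f' fi ff] [g' gi gg] hfg; rewrite (Rintegral_off_null hfg).
rewrite (Rintegral_off_null ff) (Rintegral_off_null gg) -RintegralD//.
apply: Rintegral_off_null.
have [N [mN N0 {}ff]] := ff; have [N' [mN' N'0 {}gg]] := gg.
exists (N `|` N'); split.
- exact: measurableU.
- exact: null_set_setU.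
- by move=> x /not_orP[/ff[_ e2] /gg[_ e4]]; split=> //= Dx; rewrite e2// e4.
Qed.

End NullSets.

(** * Simple and strongly measurable functions *)

Section SimpleFun.
Context {R : realType}.
Implicit Types (D : set R).

(** The values of the combination are indexed by pairs of values, so each of its
fibres is a finite union of intersections of fibres. *)
Lemma simple_fun2 (E E' E'' : zmodType) (S : set E) (S' : set E') (S'' : set E'')
    (op : E -> E' -> E'') (f : R -> E) (g : R -> E') :
  (forall x y, S x -> S' y -> S'' (op x y)) ->
  simple_fun S f -> simple_fun S' g -> simple_fun S'' (fun t => op (f t) (g t)).
Proof.
move=> opS [ff fS mf] [fg gS mg]; split.
- apply: (@sub_finite_set _ _ ((fun p => op p.1 p.2) @` (range f `*` range g))).
    by move=> _ [t _ <-]; exists (f t, g t).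
  by apply: finite_image; exact: finite_setX.
- by move=> _ [t _ <-]; apply: opS; [apply: fS|apply: gS]; exists t.
- move=> z; rewrite (_ : _ @^-1` _ = \bigcup_(p in
    (range f `*` range g) `&` [set p | op p.1 p.2 = z])
    (f @^-1` [set p.1] `&` g @^-1` [set p.2])).
    apply: fin_bigcup_measurable.
      by apply: finite_setIl; exact: finite_setX.
    by move=> p _; apply: measurableI.
  apply/seteqP; split=> [t /= <-|t [p [_ /= <-]] [/= -> ->]//].
  by exists (f t, g t); split => //=; split; exists t.
Qed.

(** Freezing the value of [s] on each of its finitely many fibres turns the
parametrized function into a finite gluing of the [G x]. *)
Lemma measurable_simple_param D (E : zmodType) (S : set E) (s : R -> E)
    (G : E -> R -> R) : measurable D -> simple_fun S s ->
  (forall x, S x -> measurable_fun D (G x)) ->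
  measurable_fun D (fun t => G (s t) t).
Proof.
move=> mD [fs sS ms] mG _ Y mY.
rewrite (_ : _ `&` _ = \bigcup_(x in range s)
  (s @^-1` [set x] `&` (D `&` G x @^-1` Y))); last first.
  apply/seteqP; split=> [t [Dt /= Yt]|t [x _ [/= <-] []]//].
  by exists (s t); [exists t|].
apply: fin_bigcup_measurable => // x rx; apply: measurableI => //.
exact: (mG _ (sS _ rx)).
Qed.

End SimpleFun.

Section Seminorm.
Context {R : realType} {E : lmodType R}.
Variables (S : set E) (nrm : E -> R).

(** Covers at once V with its norm, where [S] is everything, and V' inside the space
of all functions from V to the scalars, where the dual norm is a norm only on the
bounded linear functions. *)
Record seminorm_on : Prop := SeminormOn {
  sdom0 : S 0;
  sdom_comb : forall a x y, S x -> S y -> S (a *: x + y);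
  seminormZ : forall a x, S x -> nrm (a *: x) = `|a| * nrm x;
  seminorm_leD : forall x y, S x -> S y -> nrm (x + y) <= nrm x + nrm y }.

Hypothesis sn : seminorm_on.

Lemma sdomD x y : S x -> S y -> S (x + y).
Proof. by move=> Sx Sy; rewrite -[x]scale1r; exact: sdom_comb. Qed.

Lemma sdomZ a x : S x -> S (a *: x).
Proof. by move=> Sx; rewrite -[_ *: _]addr0; apply: sdom_comb => //; exact: sdom0. Qed.

Lemma sdomN x : S x -> S (- x).
Proof. by rewrite -scaleN1r; exact: sdomZ. Qed.

Lemma sdomB x y : S x -> S y -> S (x - y).
Proof. by move=> Sx Sy; apply: sdomD => //; exact: sdomN. Qed.

Lemma seminorm0 : nrm 0 = 0.
Proof. by rewrite -(scale0r (0 : E)) (seminormZ sn)//; [rewrite normr0 mul0r|exact: sdom0]. Qed.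

Lemma seminormN x : S x -> nrm (- x) = nrm x.
Proof. by move=> Sx; rewrite -scaleN1r (seminormZ sn)// normrN1 mul1r. Qed.

Lemma seminorm_ge0 x : S x -> 0 <= nrm x.
Proof.
move=> Sx; have := seminorm_leD sn Sx (sdomN Sx).
by rewrite subrr seminorm0 seminormN// -mulr2n pmulrn_lge0.
Qed.

Lemma seminorm_dist x y : S x -> S y -> `|nrm x - nrm y| <= nrm (x - y).
Proof.
move=> Sx Sy; rewrite ler_norml; apply/andP; split.
  have := seminorm_leD sn (sdomB Sy Sx) Sx.
  by rewrite subrK -(seminormN (sdomB Sy Sx)) opprB => ?; lra.
by have := seminorm_leD sn (sdomB Sx Sy) Sy; rewrite subrK => ?; lra.
Qed.

Section StronglyMeasurable.
Import HBSimple.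
Variable D : set R.
Hypothesis mD : measurable D.
Implicit Types f g : R -> E.

Lemma strongly_measurable_eq f g : (forall t, D t -> f t = g t) ->
  strongly_measurable S nrm D f -> strongly_measurable S nrm D g.
Proof.
move=> fg [Sf [s ss cs]]; split; first by move=> t Dt; rewrite -fg//; exact: Sf.
by exists s => // t Dt; rewrite -fg//; exact: cs.
Qed.

Lemma cvg0_le (a b : nat -> R) : (forall k, 0 <= a k <= b k) ->
  b @ \oo --> (0 : R) -> a @ \oo --> (0 : R).
Proof.
move=> ab b0; apply: (@squeeze_cvgr _ _ _ _ (cst 0) b) => //.
  exact: nearW.
exact: cvg_cst.
Qed.

Lemma strongly_measurable_comb a f g : strongly_measurable S nrm D f ->
  strongly_measurable S nrm D g ->
  strongly_measurable S nrm D (fun t => a *: f t + g t).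
Proof.
move=> [Sf [s ss cs]] [Sg [r rr cr]]; split.
  by move=> t Dt; apply: (sdom_comb sn); [exact: Sf|exact: Sg].
exists (fun k t => a *: s k t + r k t).
  by move=> k; apply: (simple_fun2 (op := fun x y => a *: x + y) (sdom_comb sn a)).
move=> t Dt; have [Ss Sr] : (forall k, S (s k t)) /\ (forall k, S (r k t)).
  by split=> k; [have [_ sS _] := ss k; apply: sS|have [_ rS _] := rr k; apply: rS];
    exists t.
apply: (@cvg0_le _ (fun k => `|a| * nrm (f t - s k t) + nrm (g t - r k t))).
  move=> k; have SB := sdomB (Sf _ Dt) (Ss k); have SB' := sdomB (Sg _ Dt) (Sr k).
  rewrite opprD addrACA -scalerBr seminorm_ge0/=; last exact: (sdom_comb sn).
  by rewrite (le_trans (seminorm_leD sn (sdomZ a SB) SB'))// (seminormZ sn).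
rewrite -[0 in X in _ --> X](addr0 0) -[X in X + _](mulr0 `|a|).
exact: (cvgD (cvgM (cvg_cst `|a|) (cs _ Dt)) (cr _ Dt)).
Qed.

(** Real measurable functions are limits of simple functions, which are here used
as coefficients of the vector [a]. *)
Lemma strongly_measurable_scale (phi : R -> R) a :
  measurable_fun D phi -> S a -> strongly_measurable S nrm D (fun t => phi t *: a).
Proof.
move=> mphi Sa; split; first by move=> t _; exact: sdomZ.
have mphi' : measurable_fun D (EFin \o phi) by exact/measurable_EFinP.
have [s cs] := approximation_sfun mD mphi'.
exists (fun k t => s k t *: a).
  move=> k; pose s' : R -> R^o := s k.
  have ss : simple_fun [set: R^o] s'.
    by split => // x; exact: (measurable_funPTI (s k)).
  by apply: (simple_fun2 (S := [set: R^o]) (S' := [set: R^o]) (op := fun x (_ : R^o) => x *: a)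
      (f := s') (g := s')) => // x y _ _; exact: sdomZ.
move=> t Dt; have /fine_cvgP[_ ct] := cs _ Dt.
apply: (@cvg0_le _ (fun k => `|phi t - s k t| * nrm a)).
  move=> k; rewrite -scalerBl seminorm_ge0; last exact: sdomZ.
  by rewrite (seminormZ sn)// lexx.
rewrite -[0 in X in _ --> X](mul0r (nrm a)); apply: cvgM; last exact: cvg_cst.
have h : (fun k => `|phi t - s k t|) @ \oo --> `|phi t - phi t|.
  exact: (cvg_norm (cvgB (cvg_cst (phi t)) ct)).
by move: h; rewrite subrr normr0.
Qed.

(** The norms of the approximating simple functions are simple and converge, the norm
being 1-Lipschitz. *)
Lemma strongly_measurable_norm f : strongly_measurable S nrm D f ->
  measurable_fun D (fun t => nrm (f t)).
Proof.
move=> [Sf [s ss cs]].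
apply: (measurable_fun_cvg (h := fun k t => nrm (s k t))).
  by move=> k; apply: (measurable_simple_param (G := fun x _ => nrm x) mD (ss k)) => x _;
    exact: measurable_cst.
move=> t Dt; have Ss k : S (s k t).
  by have [_ sS _] := ss k; apply: sS; exists t.
apply/subr_cvg0/norm_cvg0P => /=.
apply: cvg0_le (cs _ Dt) => k.
rewrite normr_ge0/= distrC; exact: seminorm_dist (Sf _ Dt) (Ss k).
Qed.

Lemma bochner_L2P f : bochner_L2 S nrm D f <->
  strongly_measurable S nrm D f /\
  lebesgue_measure.-integrable D (fun t => (nrm (f t) ^+ 2)%:E).
Proof.
have E1 : (\int[lebesgue_measure]_(t in D) `|(nrm (f t) ^+ 2)%:E| =
           \int[lebesgue_measure]_(t in D) (nrm (f t) ^+ 2)%:E)%E.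
  by apply: eq_integral => t _; rewrite gee0_abs// lee_fin sqr_ge0.
split=> [[sf fi]|[sf /integrableP[_ fi]]]; split => //; last by rewrite -E1.
apply/integrableP; split; last by rewrite E1.
by apply/measurable_EFinP; apply: measurable_funX; exact: strongly_measurable_norm.
Qed.

(** Relies on [(a + b)^2 <= 2 a^2 + 2 b^2]. *)
Lemma bochner_L2_comb a f g : bochner_L2 S nrm D f -> bochner_L2 S nrm D g ->
  bochner_L2 S nrm D (fun t => a *: f t + g t).
Proof.
move=> /bochner_L2P[sf fi] /bochner_L2P[sg gi].
have sfg := strongly_measurable_comb a sf sg; apply/bochner_L2P; split=> //.
apply: (@le_integrable _ _ R lebesgue_measure D mD _
  (fun t => (2 * a ^+ 2)%:E * (nrm (f t) ^+ 2)%:E + 2%:E * (nrm (g t) ^+ 2)%:E)%E).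
- apply/measurable_EFinP; apply: measurable_funX; exact: strongly_measurable_norm.
- move=> t Dt; have Sf := (proj1 sf) _ Dt; have Sg := (proj1 sg) _ Dt.
  rewrite -!EFinM -EFinD !abse_EFin lee_fin ger0_norm ?sqr_ge0//.
  apply: le_trans (ler_norm _).
  have n0 := seminorm_ge0 (sdom_comb sn a Sf Sg).
  have := seminorm_leD sn (sdomZ a Sf) Sg; rewrite (seminormZ sn)// => nle.
  rewrite (le_trans (_ : _ <= (`|a| * nrm (f t) + nrm (g t)) ^+ 2))//.
    by rewrite ler_sqr ?nnegrE// (le_trans n0).
  rewrite -(real_normK (num_real a)).
  have := sqr_ge0 (`|a| * nrm (f t) - nrm (g t)); nra.
- by apply: integrableD => //; apply: integrableZl.
Qed.

Lemma bochner_L2_scale (phi : R -> R) a C : (lebesgue_measure D < +oo)%E ->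
  measurable_fun D phi -> (forall t, D t -> `|phi t| <= C) -> S a ->
  bochner_L2 S nrm D (fun t => phi t *: a).
Proof.
move=> D_fin mphi phiC Sa; have sp := strongly_measurable_scale mphi Sa.
apply/bochner_L2P; split => //.
apply: (@le_integrable _ _ R lebesgue_measure D mD _ (fun t => ((C * nrm a) ^+ 2)%:E)).
- apply/measurable_EFinP; apply: measurable_funX; exact: strongly_measurable_norm.
- move=> t Dt; have na := seminorm_ge0 Sa.
  rewrite !abse_EFin lee_fin !ger0_norm ?sqr_ge0// (seminormZ sn)// ler_sqr ?nnegrE ?mulr_ge0//.
    by rewrite ler_wpM2r// phiC.
  by rewrite (le_trans (normr_ge0 _) (phiC _ Dt)).
- apply/integrableP; split; first exact: measurable_cst.
  by rewrite integral_cst// lte_mul_pinfty.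
Qed.

Lemma bochner_L2_eq f g : (forall t, D t -> f t = g t) ->
  bochner_L2 S nrm D f -> bochner_L2 S nrm D g.
Proof.
move=> fg [sf fi]; split; first exact: strongly_measurable_eq sf.
rewrite (_ : integral _ _ _ = \int[lebesgue_measure]_(t in D) (nrm (f t) ^+ 2)%:E)%E//.
by apply: eq_integral => t /set_mem Dt; rewrite fg.
Qed.

Lemma bochner_L2_0 : bochner_L2 S nrm D (fun=> 0).
Proof.
split; last by rewrite integral0_eq// => t _; rewrite seminorm0 expr0n.
apply: (@strongly_measurable_eq (fun=> (0 : R) *: 0)).
  by move=> t _; rewrite scaler0.
by apply: strongly_measurable_scale; [exact: measurable_cst|exact: (sdom0 sn)].
Qed.

Lemma bochner_L2_sum (I : Type) (r : seq I) (f : I -> R -> E) :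
  (forall i, bochner_L2 S nrm D (f i)) ->
  bochner_L2 S nrm D (fun t => \sum_(i <- r) f i t).
Proof.
move=> fL; elim: r => [|i r IH].
  by apply: bochner_L2_eq bochner_L2_0 => t _; rewrite big_nil.
apply: bochner_L2_eq (bochner_L2_comb 1 (fL i) IH) => t _.
by rewrite big_cons scale1r.
Qed.

Lemma bochner_L2_subset (D' : set R) f : measurable D' -> D' `<=` D ->
  bochner_L2 S nrm D f -> bochner_L2 S nrm D' f.
Proof.
move=> mD' D'D /bochner_L2P[[Sf [s ss cs]] fi]; split.
  by split=> [t /D'D/Sf//|]; exists s => // t /D'D/cs.
have /integrableP[_] := @integrableS _ _ R lebesgue_measure _ _ _ mD mD' D'D fi.
by congr (_ < _)%E; apply: eq_integral => t _; rewrite gee0_abs// lee_fin sqr_ge0.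
Qed.

End StronglyMeasurable.
End Seminorm.

(** * Integrability of pairings *)

Section Pairing.
Context {R : realType} {E E' : lmodType R}.
Variables (S : set E) (nrm : E -> R) (S' : set E') (nrm' : E' -> R).
Hypotheses (sn : seminorm_on S nrm) (sn' : seminorm_on S' nrm').
Variables (D : set R) (G : R -> E -> E' -> R) (C : R).
Hypothesis mD : measurable D.
Hypothesis mG : forall x y, S x -> S' y -> measurable_fun D (fun s => G s x y).
Hypothesis GBl : forall s, D s -> forall x x' y, S x -> S x' -> S' y ->
  G s (x - x') y = G s x y - G s x' y.
Hypothesis GBr : forall s, D s -> forall x y y', S x -> S' y -> S' y' ->
  G s x (y - y') = G s x y - G s x y'.
Hypothesis GC : forall s, D s -> forall x y, S x -> S' y ->
  `|G s x y| <= C * (nrm x * nrm' y).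

(** Along simple approximations [fk] and [gk] the pairing takes finitely many forms
[G s x y], and it converges because
[G f g - G fk gk = G (f - fk) gk + G f (g - gk)]. *)
Lemma pairing_measurable f g :
  strongly_measurable S nrm D f -> strongly_measurable S' nrm' D g ->
  measurable_fun D (fun s => G s (f s) (g s)).
Proof.
move=> [Sf [fk ffk cf]] [Sg [gk ggk cg]].
apply: (measurable_fun_cvg (h := fun k s => G s (fk k s) (gk k s))).
  move=> k.
  apply: (measurable_simple_param (G := fun y s => G s (fk k s) y) mD (ggk k)) => y Sy.
  by apply: (measurable_simple_param (G := fun x s => G s x y) mD (ffk k)) => x Sx; exact: mG.
move=> s Ds.
have Sfk k : S (fk k s) by have [_ h _] := ffk k; apply: h; exists s.
have Sgk k : S' (gk k s) by have [_ h _] := ggk k; apply: h; exists s.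
apply/subr_cvg0/norm_cvg0P => /=.
pose a k := nrm (f s - fk k s); pose b k := nrm' (g s - gk k s).
apply: (@cvg0_le _ _
  (fun k => `|C| * (a k * (nrm' (g s) + b k)) + `|C| * (nrm (f s) * b k))).
  move=> k; rewrite normr_ge0/=.
  have SB := sdomB sn (Sf _ Ds) (Sfk k); have SB' := sdomB sn' (Sg _ Ds) (Sgk k).
  have -> : G s (fk k s) (gk k s) - G s (f s) (g s) =
      - (G s (f s - fk k s) (gk k s) + G s (f s) (g s - gk k s)).
    by rewrite (GBl Ds (Sf _ Ds) (Sfk k) (Sgk k)) (GBr Ds (Sf _ Ds) (Sg _ Ds) (Sgk k)); ring.
  rewrite normrN (le_trans (ler_normD _ _))//.
  have GC' x y : S x -> S' y -> `|G s x y| <= `|C| * (nrm x * nrm' y).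
    move=> Sx Sy; rewrite (le_trans (GC Ds Sx Sy))// ler_wpM2r ?ler_norm//.
    by rewrite mulr_ge0// ?(seminorm_ge0 sn)// (seminorm_ge0 sn').
  apply: lerD; last by apply: GC' => //; exact: Sf.
  rewrite (le_trans (GC' _ _ _ _))// ler_wpM2l// ler_wpM2l ?(seminorm_ge0 sn)//.
  have := seminorm_leD sn' (Sg _ Ds) (sdomN sn' SB').
  by rewrite (seminormN sn' SB') opprB addrC subrK.
have a0 : a @ \oo --> (0 : R) by exact: cf.
have b0 : b @ \oo --> (0 : R) by exact: cg.
have -> : (0 : R) = `|C| * (0 * (nrm' (g s) + 0)) + `|C| * (nrm (f s) * 0) by ring.
apply: cvgD; apply: cvgM; try exact: cvg_cst; apply: cvgM => //; try exact: cvg_cst.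
by apply: cvgD => //; exact: cvg_cst.
Qed.

(** The pairing is dominated by [C (a^2 + b^2)], where [a] and [b] are the two norms. *)
Lemma pairing_integrable f g : bochner_L2 S nrm D f -> bochner_L2 S' nrm' D g ->
  lebesgue_measure.-integrable D (EFin \o (fun s => G s (f s) (g s))).
Proof.
move=> /(bochner_L2P sn mD)[sf fi] /(bochner_L2P sn' mD)[sg gi].
apply: (@le_integrable _ _ R lebesgue_measure D mD _ (fun s =>
  `|C|%:E * (nrm (f s) ^+ 2)%:E + `|C|%:E * (nrm' (g s) ^+ 2)%:E)%E).
- by apply/measurable_EFinP; exact: pairing_measurable.
- move=> s Ds; have Sf := (proj1 sf) _ Ds; have Sg := (proj1 sg) _ Ds.
  rewrite -!EFinM -EFinD !abse_EFin lee_fin; apply: le_trans (ler_norm _).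
  rewrite (le_trans (GC Ds Sf Sg))//.
  have nf := seminorm_ge0 sn Sf; have ng := seminorm_ge0 sn' Sg.
  rewrite (le_trans (ler_wpM2r _ (ler_norm C))) ?mulr_ge0// -mulrDr ler_wpM2l//.
  have := sqr_ge0 (nrm (f s) - nrm' (g s)); nra.
- by apply: integrableD => //; apply: integrableZl.
Qed.

End Pairing.

(** * The dual space *)

Section Dual.
Context {R : realType} {V : completeNormedModType R}.
Implicit Types f g : V -> R.

Lemma seminorm_norm : seminorm_on [set: V] (fun x => `|x|).
Proof. by split => // [a x|x y] _ => [|_]; [rewrite normrZ|exact: ler_normD]. Qed.

Lemma dual0 f : dual f -> f 0 = 0.
Proof. by move=> [lf _]; have := lf (-1) 0 0; rewrite scaler0 addr0 mulN1r addNr. Qed.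

Lemma dualZ f a x : dual f -> f (a *: x) = a * f x.
Proof. by move=> df; have := (proj1 df) a x 0; rewrite addr0 (dual0 df) addr0. Qed.

Lemma dualB f x y : dual f -> f (x - y) = f x - f y.
Proof. by move=> df; have := (proj1 df) (-1) y x; rewrite scaleN1r mulN1r !(addrC (- _)). Qed.

Lemma dual_norm_has_sup f : dual f ->
  has_sup [set `|f x| | x in [set x : V | `|x| <= 1]].
Proof.
move=> df; have [_ [C fC]] := df; split.
  by exists `|f 0|; exists 0 => //=; rewrite normr0.
exists `|C| => _ [x /= x1 <-]; rewrite (le_trans (fC x))//.
rewrite (le_trans (ler_wpM2r _ (ler_norm C)))// -[leRHS]mulr1.
by rewrite ler_wpM2l.
Qed.

Lemma dual_norm_le f C : (forall x, `|x| <= 1 -> `|f x| <= C) -> dual_norm f <= C.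
Proof.
move=> fC; apply: ge_sup; first by exists `|f 0|; exists 0 => //=; rewrite normr0.
by move=> _ [x /= /fC fx <-].
Qed.

Lemma le_dual_norm f x : dual f -> `|f x| <= dual_norm f * `|x|.
Proof.
move=> df; have [->|x0] := eqVneq x 0.
  by rewrite (dual0 df) !normr0 mulr0.
have nx : 0 < `|x| by rewrite normr_gt0.
rewrite -ler_pdivrMr//.
apply: (ub_le_sup (proj2 (dual_norm_has_sup df))).
exists (`|x|^-1 *: x) => /=.
  by rewrite normrZ normfV normr_id mulVf// gt_eqF.
by rewrite (dualZ _ _ df) normrM normfV normr_id mulrC.
Qed.

Lemma dual_norm_ge0 f : dual f -> 0 <= dual_norm f.
Proof.
move=> df; rewrite (le_trans (normr_ge0 (f 0)))//.
by apply: (ub_le_sup (proj2 (dual_norm_has_sup df))); exists 0 => //=; rewrite normr0.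
Qed.

Lemma dual_normZ_le a f : dual f -> dual_norm (a *: f) <= `|a| * dual_norm f.
Proof.
move=> df; apply: dual_norm_le => x x1.
rewrite /= normrM ler_wpM2l// (le_trans (le_dual_norm x df))//.
by rewrite -[leRHS]mulr1 ler_wpM2l// dual_norm_ge0.
Qed.

Lemma seminorm_dual : seminorm_on (dual : set (V -> R)) dual_norm.
Proof.
have dP a f g : dual f -> dual g -> dual (a *: f + g : V -> R).
  move=> [lf [C fC]] [lg [C' gC]]; split.
    move=> b x y; have e z : (a *: f + g) z = a * f z + g z by [].
    by rewrite !e lf lg /=; ring.
  exists (`|a| * C + C') => x; rewrite !fctE mulrDl -mulrA.
  by rewrite (le_trans (ler_normD _ _))// lerD// normrM ler_wpM2l.
have d0 : dual (0 : V -> R).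
  have e z : (0 : V -> R) z = 0 by [].
  split; first by move=> a x y; rewrite !e /= mulr0 addr0.
  by exists 0 => x; rewrite e normr0 mul0r.
split => //.
- move=> a f df; apply/eqP; rewrite eq_le dual_normZ_le//=.
  have [->|a0] := eqVneq a 0.
    rewrite normr0 mul0r; apply: dual_norm_ge0.
    by rewrite scale0r.
  have daf : dual (a *: f) by rewrite -[_ *: _]addr0; exact: dP.
  rewrite -ler_pdivlMl ?normr_gt0// -normfV.
  by have := dual_normZ_le a^-1 daf; rewrite scalerA mulVf// scale1r.
- move=> f g df dg; apply: dual_norm_le => x x1.
  rewrite !fctE (le_trans (ler_normD _ _))// lerD//.
    by rewrite (le_trans (le_dual_norm x df))// ler_piMr// dual_norm_ge0.
  by rewrite (le_trans (le_dual_norm x dg))// ler_piMr// dual_norm_ge0.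
Qed.

Lemma duality_integrable (D : set R) (f : R -> V -> R) (v : R -> V) :
  measurable D -> L2V' D f -> L2V D v ->
  lebesgue_measure.-integrable D (EFin \o (fun s => f s (v s))).
Proof.
move=> mD; apply: (pairing_integrable (C := 1) (G := fun _ (l : V -> R) x => l x)
  seminorm_dual seminorm_norm mD) => //.
- by move=> s _ f0 x y df _ _; rewrite dualB.
- by move=> s _ f0 x df _; rewrite mul1r le_dual_norm.
Qed.

End Dual.

(** * Inner products *)

Section InnerProduct.
Context {R : realType} {H : completeNormedModType R}.
Variable ip : {dot H for (@idfun R)}.

Lemma ipC x y : ip x y = ip y x.
Proof. by rewrite hermC expr0 mul1r. Qed.

Lemma ipPl c x y z : ip (c *: x + y) z = c * ip x z + ip y z.
Proof. by rewrite linearDl linearZl_LR. Qed.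

Lemma ipPr c x y z : ip z (c *: x + y) = c * ip z x + ip z y.
Proof. by rewrite ipC ipPl !(ipC z). Qed.

Lemma ip0l z : ip 0 z = 0.
Proof. exact: linear0l. Qed.

Lemma ip_suml (I : Type) (r : seq I) (c : I -> R) (h : I -> H) z :
  ip (\sum_(i <- r) c i *: h i) z = \sum_(i <- r) c i * ip (h i) z.
Proof.
elim: r => [|i r IH]; first by rewrite !big_nil ip0l.
by rewrite !big_cons ipPl IH.
Qed.

Hypothesis hip : hilbert ip.

(** Expands the square of the norm of [|y|^2 x - (x, y) y]. *)
Lemma cauchy_schwarz x y : `|ip x y| <= `|x| * `|y|.
Proof.
have [->|y0] := eqVneq y 0; first by rewrite ipC ip0l !normr0 mulr0.
have ny : 0 < `|y| by rewrite normr_gt0.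
rewrite -ler_sqr ?nnegrE ?mulr_ge0// real_normK ?num_real//.
have := sqr_ge0 `| `|y| ^+ 2 *: x + (- ip x y) *: y|.
rewrite hip ipPl !ipPr -[_ *: y]addr0 !ipPl !ipPr !ip0l !(ipC _ 0) !ip0l -!hip (ipC y x).
move=> h; rewrite -(ler_pM2l (exprn_gt0 2 ny)); nra.
Qed.

End InnerProduct.

(** * Vector-valued polynomials *)

Section PolynomialCalculus.
Context {R : realType} {V : normedModType R}.

Lemma is_derive_scale (phi : R -> R) (a : V) (s d : R) :
  is_derive s 1 phi d -> is_derive s 1 (fun r => phi r *: a) (d *: a).
Proof.
move=> [dphi vphi].
have cv : (h^-1 *: (((fun r => phi r *: a) \o shift s) (h *: 1) - phi s *: a))
    @[h --> 0^'] --> d *: a.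
  rewrite -vphi; apply: cvg_trans (cvgZr_tmp (a := a) dphi).
  apply: near_eq_cvg; near=> h => /=.
  by rewrite -scalerBl scalerA.
apply: DeriveDef; last exact/cvg_lim.
by apply/cvg_ex; exists (d *: a).
Unshelve. all: by end_near. Qed.

Definition vpoly (q : nat) (a : 'I_q -> V) (s : R) : V := \sum_(i < q) s ^+ i *: a i.

(** The term [i = 0] vanishes because of its factor [i], whatever [0.-1] is. *)
Definition dvpoly (q : nat) (a : 'I_q -> V) (s : R) : V :=
  \sum_(i < q) (i%:R * s ^+ i.-1) *: a i.

Lemma is_derive_vpoly q (a : 'I_q -> V) (s : R) :
  is_derive s 1 (vpoly a) (dvpoly a s).
Proof.
have -> : vpoly a = \sum_(i < q) (fun r : R => r ^+ i *: a i).
  by apply/funext => r; rewrite fct_sumE.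
apply: is_derive_sum => i; apply: is_derive_scale.
have h : is_derive s 1 (id : R -> R) 1 := is_derive_id s 1.
have := is_deriveX i h.
rewrite (_ : id ^+ i = (fun r : R => r ^+ i)); last by rewrite exprfctE.
by rewrite /GRing.scale /= mulr1.
Qed.

Lemma continuous_vpoly q (a : 'I_q -> V) : continuous (vpoly a).
Proof.
move=> s; apply: differentiable_continuous; apply/derivable1_diffP.
exact: (@ex_derive _ _ _ _ _ _ _ (is_derive_vpoly a s)).
Qed.

Lemma derive1_vpoly q (a : 'I_q -> V) (w : R -> V) (b c s : R) :
  (forall r, b < r < c -> w r = vpoly a r) -> b < s < c ->
  derive1 w s = dvpoly a s.
Proof.
move=> wp /andP[bs sc].
rewrite derive1E -(@derive_val _ _ _ _ _ _ _ (is_derive_vpoly a s)).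
apply: near_eq_derive; near=> r; apply: wp; apply/andP; split; near: r.
  exact: lt_nbhsr.
exact: lt_nbhsl.
Unshelve. all: by end_near. Qed.

End PolynomialCalculus.

(** * Partitions of the time interval *)

Section Partition.
Context {R : realType}.
Variables (T : R) (N : nat) (t : nat -> R).
Hypothesis ht : time_partition T N t.

Lemma node_le m n : (m <= n <= N)%N -> t m <= t n.
Proof.
have [_ _ tS] := ht.
move=> /andP[]; elim: n => [|n IH]; first by rewrite leqn0 => /eqP ->.
rewrite leq_eqVlt ltnS => /predU1P[->//|mn nN].
by rewrite (le_trans (IH mn (ltnW nN)))// ltW// tS.
Qed.

Lemma node_bounds n : (n <= N)%N -> 0 <= t n <= T.
Proof.
have [<- <- _] := ht.
by move=> nN; rewrite !node_le// nN /=.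
Qed.

Lemma Jn_ge0 n s : (n < N)%N -> Jn t n s -> 0 < s <= T.
Proof.
move=> nN; rewrite /Jn /= in_itv/= => /andP[a b].
have /andP[h1 _] := node_bounds (ltnW nN); have /andP[_ h2] := node_bounds nN.
by rewrite (le_lt_trans h1 a) (le_trans b h2).
Qed.

Lemma Jn_cover k s : (k <= N)%N -> 0 < s <= t k ->
  exists2 n, (n < k)%N & Jn t n s.
Proof.
have [t0 _ _] := ht.
elim: k => [_|k IH kN]; first by rewrite t0 => /andP[/lt_le_trans h /h]; rewrite ltxx.
move=> /andP[s0 sk]; have [stk|tks] := leP s (t k).
  by have [||n nk] := IH; [exact: ltnW|rewrite s0|exists n => //; exact: ltnW].
by exists k => //; rewrite /Jn/= in_itv/= tks.
Qed.

Lemma Jn_inj m n s : (m < N)%N -> (n < N)%N -> Jn t m s -> Jn t n s -> m = n.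
Proof.
rewrite /Jn/= !in_itv/= => mN nN /andP[a b] /andP[c d].
apply/eqP; rewrite eqn_leq; apply/andP; split; rewrite leqNgt; apply/negP => h.
  (* two distinct steps are separated by the right end of the first one *)
  have := @node_le n.+1 m; rewrite h (ltnW mN) => /(_ isT) e.
  by have := lt_le_trans a (le_trans d e); rewrite ltxx.
have := @node_le m.+1 n; rewrite h (ltnW nN) => /(_ isT) e.
by have := lt_le_trans c (le_trans b e); rewrite ltxx.
Qed.

Definition open_step (n : nat) : set R := `]t n, t n.+1[.

Lemma measurable_open_step n : measurable (open_step n).
Proof. exact: measurable_itv. Qed.

Lemma open_step_Jn n s : open_step n s -> Jn t n s.
Proof. by rewrite /open_step /Jn /= !in_itv /= => /andP[-> /ltW]. Qed.

Lemma open_step_sub n : (n < N)%N -> open_step n `<=` `]0, T[.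
Proof.
move=> nN s; rewrite /open_step /= !in_itv/= => /andP[a b].
have /andP[h1 _] := node_bounds (ltnW nN); have /andP[_ h2] := node_bounds nN.
by rewrite (le_lt_trans h1 a) (lt_le_trans b h2).
Qed.

Lemma near_open_step n : (n < N)%N -> \forall s \near (t n)^'+, open_step n s.
Proof.
move=> nN; have [_ _ /(_ _ nN) tt] := ht; near=> s.
rewrite /open_step/= in_itv/=; apply/andP; split; near: s.
  exact: nbhs_right_gt.
exact: nbhs_right_lt.
Unshelve. all: by end_near. Qed.

(** Passing to open steps keeps the derivative of a piecewise polynomial away from the
nodes, where it has no meaning. *)
Lemma Rintegral_Jn n (f : R -> R) :
  Rintegral lebesgue_measure (Jn t n) f = Rintegral lebesgue_measure (open_step n) f.
Proof.
apply: Rintegral_off_null; exists [set t n.+1]; split => //.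
- exact: lebesgue_measure_set1.
- move=> s sn; split=> //; split; last exact: open_step_Jn.
  rewrite /Jn /open_step/= !in_itv/= => /andP[-> /=].
  by rewrite le_eqVlt => /predU1P[/sn|].
Qed.

(** The integrable representative is extended by zero outside the time interval, and
the last step contains the additional point [T]. *)
Lemma Rintegral_steps (f : R -> R) : ae_integrable lebesgue_measure `]0, T[ f ->
  Rintegral lebesgue_measure `]0, T[ f =
  \sum_(n < N) Rintegral lebesgue_measure (Jn t n) f.
Proof.
move=> [g gi fg]; pose h := g \_ `]0, T[.
have hi : lebesgue_measure.-integrable setT (EFin \o h).
  rewrite (_ : EFin \o h = (EFin \o g) \_ `]0, T[); 
    first exact: (proj1 (integrable_mkcond (mu := lebesgue_measure) _ (measurable_itv _)) gi).
  by apply/funext => s; rewrite /h /= !patchE; case: ifP.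
have [t0 tN _] := ht.
have [Z [mZ Z0 Zfg]] := fg.
(* the point [T] is adjoined to the null set, as [h] is cut off at the open interval *)
have fh (D : set R) : D `<=` `]0, T] ->
    Rintegral lebesgue_measure D f = Rintegral lebesgue_measure D h.
  move=> DT; apply: Rintegral_off_null; exists (Z `|` [set T]); split.
  - exact: measurableU.
  - apply: null_set_setU => //; exact: lebesgue_measure_set1.
  - move=> s /not_orP[/Zfg[_ e] sT]; split=> // /DT.
    rewrite /= !in_itv/= le_eqVlt => /andP[s0 /predU1P[/sT//|sT']].
    have sJ : `]0, T[%classic s by rewrite /= in_itv/= s0.
    by rewrite e// /h patchE mem_set.
have -> : Rintegral lebesgue_measure `]0, T[ f = Rintegral lebesgue_measure `]0, T] f.
  apply: Rintegral_off_null; exists [set T]; split => //.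
    exact: lebesgue_measure_set1.
  move=> s sT; split=> //; rewrite /= !in_itv/=.
  split=> /andP[-> /=]; first exact: ltW.
  by rewrite le_eqVlt => /predU1P[/sT|].
rewrite fh// (eq_bigr (fun n : 'I_N => Rintegral lebesgue_measure (Jn t n) h)); last first.
  by move=> n _; apply: fh => s /(Jn_ge0 (ltn_ord n)); rewrite /= in_itv.
have key k : (k <= N)%N -> Rintegral lebesgue_measure `]0, t k] h =
    \sum_(n < k) Rintegral lebesgue_measure (Jn t n) h.
  elim: k => [_|k IH kN].
    by rewrite big_ord0 t0 set_itvoc0 Rintegral_set0.
  rewrite big_ord_recr/= -(IH (ltnW kN)).
  have hk : lebesgue_measure.-integrable `]0, t k.+1] (EFin \o h).
    exact: (@integrableS _ _ R lebesgue_measure setT).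
  have tk0 : (BRight (0 : R) <= BRight (t k))%O.
    by rewrite bnd_simp; have /andP[] := node_bounds (ltnW kN).
  have tkS : (BRight (t k) <= BRight (t k.+1))%O.
    by rewrite bnd_simp; apply: node_le; rewrite leqnSn.
  by rewrite /Jn -(Rintegral_itvB hk tk0 tkS) addrC subrK.
by rewrite -tN key.
Qed.

End Partition.

(** * The pairing with the operator *)

Section Operator.
Context {R : realType} {V : completeNormedModType R}.
Variables (T : R) (A : R -> V -> V -> R) (alpha M : R).
Hypothesis hA : admissible_operator T A alpha M.

Lemma operator_off_null : exists Z : set R, [/\ measurable Z, lebesgue_measure Z = 0%E &
  forall s, ~ Z s -> `]0, T[%classic s ->
    [/\ forall w, dual (A s w),
        forall w w' v, A s (w + w') v = A s w v + A s w' v,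
        forall w w' v, A s (w - w') v = A s w v - A s w' v
      & forall w v, `|A s w v| <= M * (`|w| * `|v|)]].
Proof.
have [_ _ _ [Z [mZ Z0 Zs]]] := hA; exists Z; split => // s nZs sT.
have [dA lA bA _] : [/\ forall w, dual (A s w),
            forall a w w' v, A s (a *: w + w') v = a * A s w v + A s w' v,
            forall w v, `|A s w v| <= M * `|w| * `|v|
          & forall v, alpha * `|v| ^+ 2 <= A s v v].
  by apply: contrapT => h; apply: nZs; apply: Zs => /= h'; apply: h; exact: h'.
split => //.
- by move=> w w' v; have := lA 1 w w' v; rewrite scale1r mul1r.
- by move=> w w' v; have := lA (-1) w' w v; rewrite scaleN1r mulN1r !(addrC (- _)).
- by move=> w v; rewrite mulrA.
Qed.

(** The representative is the pairing with [A s] replaced by zero on the null set where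
the properties of [A s] fail; it has these properties everywhere. *)
Lemma operator_ae_integrable (D : set R) (w v : R -> V) : measurable D ->
  D `<=` `]0, T[ -> L2V D w -> L2V D v ->
  ae_integrable lebesgue_measure D (fun s => A s (w s) (v s)).
Proof.
move=> mD DT Lw Lv; have [Z [mZ Z0 ZA]] := operator_off_null.
have [_ M0 mA _] := hA.
pose G s x y := \1_(~` Z) s * A s x y.
exists (fun s => G s (w s) (v s)).
  have GZ s x y : Z s -> G s x y = 0.
    by move=> Zs; rewrite /G indicE memNset ?mul0r//; apply.
  have GA s x y : ~ Z s -> G s x y = A s x y.
    by move=> Zs; rewrite /G indicE mem_set ?mul1r.
  apply: (pairing_integrable (C := M) seminorm_norm seminorm_norm mD) Lw Lv.
  - move=> x y _ _; apply: measurable_funM.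
      by apply: measurable_indic; exact: measurableC.
    exact: measurable_funS (mA x y).
  - move=> s /DT sT x x' y _ _ _; have [Zs|/[dup] nZs /ZA/(_ sT)[_ _ lA _]] := pselect (Z s).
      by rewrite !GZ// subr0.
    by rewrite !GA.
  - move=> s /DT sT x x' y _ _ _; have [Zs|/[dup] nZs /ZA/(_ sT)[dA _ _ _]] := pselect (Z s).
      by rewrite !GZ// subr0.
    by rewrite !GA// dualB.
  - move=> s /DT sT x y _ _; have [Zs|/[dup] nZs /ZA/(_ sT)[_ _ _ bA]] := pselect (Z s).
      by rewrite GZ// normr0 !mulr_ge0// ltW.
    by rewrite GA.
exists Z; split => // s nZs; split => // _.
by rewrite /G indicE mem_set ?mul1r.
Qed.

End Operator.

(** * Broken functions *)

Section BrokenFunctions.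
Context {R : realType} {V H : completeNormedModType R}.
Variables (ipH : {dot H for (@idfun R)}) (iota : {linear V -> H}).
Hypotheses (hH : hilbert ipH) (iota_cont : continuous iota).
Variables (T : R) (q N : nat) (t : nat -> R).
Hypothesis ht : time_partition T N t.
Implicit Types (w v : bfun V H) (f : R -> V).

Local Notation J n := (open_step t n).
Local Notation poly := (piecewise_poly q N t).
Local Notation bf := (bfun_of ipH iota).

Local Hint Resolve measurable_open_step : core.

Lemma lebesgue_itv_fin (a b : R) (x y : bool) :
  (lebesgue_measure [set` Interval (BSide x a) (BSide y b)] < +oo)%E.
Proof. by rewrite lebesgue_measure_itv/=; case: ifPn => // _; rewrite -EFinD ltry. Qed.

Lemma iota_bounded : exists2 C, 0 <= C & forall x, `|iota x| <= C * `|x|.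
Proof.
have /linear_boundedP/pinfty_ex_gt0[C C0 hC] :=
  proj2 (linear_bounded_continuous iota) iota_cont.
by exists C => //; exact: ltW.
Qed.

(** The embedding of H into V', which is where the time derivative of a V-valued
polynomial lives. *)
Lemma dual_ip h : dual (fun x => ipH h (iota x)).
Proof.
have [C C0 hC] := iota_bounded.
split; first by move=> a x y; rewrite linearP /= ipPr.
exists (`|h| * C) => x; rewrite (le_trans (cauchy_schwarz hH _ _))// -mulrA.
by rewrite ler_wpM2l.
Qed.

Lemma poly_piece f n : poly f -> (n < N)%N ->
  exists a : 'I_q.+1 -> V, forall s, Jn t n s -> f s = vpoly a s.
Proof. by move=> pf nN; have [a fa] := pf n nN; exists a. Qed.

Lemma exprn_bound (b c s : R) i : b < s < c -> `|s ^+ i| <= (`|b| + `|c|) ^+ i.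
Proof.
move=> /andP[bs sc]; rewrite normrX lerXn2r ?nnegrE ?addr_ge0//.
have := ler_norm (- b); have := ler_norm c; rewrite normrN.
have := normr_ge0 b; have := normr_ge0 c.
by move=> *; rewrite ler_norml; apply/andP; split; lra.
Qed.

Lemma measurable_monomial (c : R) i (D : set R) :
  measurable_fun D (fun s : R => c * s ^+ i).
Proof.
by apply: measurable_funM; [exact: measurable_cst|apply: measurable_funX; exact: measurable_id].
Qed.

Lemma L2V_vpoly n (a : 'I_q.+1 -> V) : L2V (J n) (vpoly a).
Proof.
apply: (bochner_L2_sum seminorm_norm) => // i.
apply: (bochner_L2_scale seminorm_norm (measurable_open_step t n) (C := (`|t n| + `|t n.+1|) ^+ i)) => //.
- exact: lebesgue_itv_fin.
- by move=> s; rewrite /open_step /= in_itv/=; exact: exprn_bound.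
Qed.

Lemma L2V'_dvpoly n (a : 'I_q.+1 -> V) :
  L2V' (J n) (fun s x => ipH (iota (dvpoly a s)) (iota x)).
Proof.
pose l (i : 'I_q.+1) : V -> R := fun x => ipH (iota (a i)) (iota x).
(* the functionals [l i] are the coefficients in V' of the derivative *)
apply: (@bochner_L2_eq _ _ _ _ _ (fun s => \sum_(i < q.+1) (i%:R * s ^+ i.-1) *: l i)).
  move=> s _; apply/funext => x; rewrite fct_sumE /dvpoly linear_sum/=.
  under [in RHS]eq_bigr do rewrite linearZ /=.
  by rewrite ip_suml.
apply: (bochner_L2_sum seminorm_dual) => // i.
apply: (bochner_L2_scale seminorm_dual (measurable_open_step t n)
  (C := i%:R * (`|t n| + `|t n.+1|) ^+ i.-1)) => //.
- exact: lebesgue_itv_fin.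
- exact: measurable_monomial.
- move=> s; rewrite /open_step /= in_itv/= => sJ.
  by rewrite normrM normr_nat ler_wpM2l// exprn_bound.
- exact: dual_ip.
Qed.

Lemma poly_derive1 f n a s : (forall s, Jn t n s -> f s = vpoly a s) ->
  J n s -> derive1 f s = @dvpoly R V q.+1 a s.
Proof.
move=> fa; rewrite /open_step/= in_itv/= => sJ.
apply: (derive1_vpoly (b := t n) (c := t n.+1)) => // r rJ; apply: fa.
by apply: open_step_Jn; rewrite /open_step/= in_itv.
Qed.

(** What the form and the norms need from a function on each step. It holds both for
the discrete functions and for the continuous solution, and passes to differences. *)
Definition regular w : Prop := forall n, (n < N)%N ->
  [/\ L2V (J n) (valV w), L2V' (J n) (der w) & cvg (valH w s @[s --> (t n)^'+])].

Lemma regular_Stau f : poly f -> regular (bf f).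
Proof.
move=> pf n nN; have [a fa] := poly_piece pf nN; split.
- apply: (bochner_L2_eq _ (L2V_vpoly n a)) => // s sJ.
  by rewrite /= fa//; exact: open_step_Jn.
- apply: (bochner_L2_eq _ (L2V'_dvpoly n a)) => // s sJ.
  by rewrite /= (poly_derive1 fa).
- apply/cvg_ex; exists (iota (vpoly a (t n))).
  have c : (iota \o vpoly a) s @[s --> (t n)^'+] --> iota (vpoly a (t n)).
    apply: cvg_at_right_filter; apply: continuous_comp; last exact: iota_cont.
    exact: continuous_vpoly.
  apply: cvg_trans c; apply: near_eq_cvg.
  apply: filterS (near_open_step ht nN) => s sJ.
  by rewrite /= fa//; exact: open_step_Jn.
Qed.

Lemma cvg_at_right_Xspace w s : {within `[0, T], continuous (valH w)} ->
  0 <= s < T -> valH w r @[r --> s^'+] --> valH w s.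
Proof.
move=> /subspace_continuousP cw /andP[s0 sT].
have sI : `[0, T]%classic s by rewrite /= in_itv/= s0 ltW.
apply: cvg_trans (cw _ sI); apply: cvg_app => P /= wP.
have {}wP : \forall r \near s, `[0, T]%classic r -> P r by exact: wP.
have {}wP : \forall r \near s^'+, `[0, T]%classic r -> P r by exact: cvg_at_right_filter wP.
near=> r; have := near wP r; apply => //; rewrite /= in_itv/=.
apply/andP; split.
  apply: (le_trans s0); apply: ltW; near: r; exact: nbhs_right_gt.
apply: ltW; near: r; exact: nbhs_right_lt.
Unshelve. all: by end_near. Qed.

Lemma node_ltT n : (n < N)%N -> t n < T.
Proof.
move=> nN; have [_ _ /(_ _ nN) h] := ht; rewrite (lt_le_trans h)//.
by have /andP[] := node_bounds ht nN.
Qed.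

(** The representative in C([0, T]; H) is continuous from the right at each node but the
last one. *)
Lemma rtrace_Xspace w n : Xspace ipH iota T w -> (n < N)%N ->
  rtrace t w n = valH w (t n).
Proof.
move=> [_ _ _ cw _] nN; apply/cvg_lim => //; apply: cvg_at_right_Xspace cw _.
by have /andP[-> _] := node_bounds ht (ltnW nN); rewrite node_ltT.
Qed.

Lemma regular_Xspace w : Xspace ipH iota T w -> regular w.
Proof.
move=> [Lw Lw' _ cw _] n nN; have JT := open_step_sub ht nN; split.
- by apply: (bochner_L2_subset seminorm_norm _ _ JT Lw) => //; exact: measurable_itv.
- by apply: (bochner_L2_subset seminorm_dual _ _ JT Lw') => //; exact: measurable_itv.
- apply/cvg_ex; exists (valH w (t n)); apply: cvg_at_right_Xspace cw _.
  by have /andP[-> _] := node_bounds ht (ltnW nN); rewrite node_ltT.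
Qed.

Lemma regular_sub w v : regular w -> regular v -> regular (bfun_sub w v).
Proof.
move=> rw rv n nN; have [Lw Lw' cw] := rw n nN; have [Lv Lv' cv] := rv n nN; split.
- apply: (bochner_L2_eq _ (bochner_L2_comb seminorm_norm _ (-1) Lv Lw)) => // s _.
  by rewrite scaleN1r addrC.
- apply: (bochner_L2_eq _ (bochner_L2_comb seminorm_dual _ (-1) Lv' Lw')) => // s _.
  by apply/funext => x /=; rewrite scaleN1r addrC.
- exact: is_cvgB.
Qed.

Lemma poly_sub f g : poly f -> poly g -> poly (fun s => f s - g s).
Proof.
move=> pf pg n nN; have [a fa] := pf n nN; have [b gb] := pg n nN.
exists (fun i => a i - b i) => s sJ; rewrite fa// gb// -sumrB.
by apply: eq_bigr => i _; rewrite scalerBr.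
Qed.

(** A piecewise polynomial is a finite sum of fixed vectors with the coefficients
[\1_(Jn t n) s * s ^+ i]. *)
Lemma L2V_Stau f : poly f -> L2V `]0, T[ f.
Proof.
move=> pf; have /choice[a fa] : forall n : 'I_N, exists a : 'I_q.+1 -> V,
    forall s, Jn t n s -> f s = vpoly a s by move=> n; exact: poly_piece.
have mT : measurable `]0, T[ by exact: measurable_itv.
apply: (@bochner_L2_eq _ _ _ _ _ (fun s =>
  \sum_(n < N) \sum_(i < q.+1) (\1_(Jn t n) s * s ^+ i) *: a n i)).
  move=> s; rewrite /= in_itv/= => /andP[s0 sT].
  have [_ tN _] := ht.
  have [|n nN sn] := @Jn_cover _ T N t ht N s (leqnn _).
    by rewrite s0 tN ltW.
  rewrite (bigD1 (Ordinal nN))//= [X in _ + X]big1 ?addr0; last first.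
    move=> m mn; apply: big1 => i _; rewrite indicE memNset ?mul0r ?scale0r//.
    move=> sm; move/eqP: mn; apply; apply: val_inj => /=.
    exact: (Jn_inj ht _ _ sm sn).
  rewrite (fa (Ordinal nN) s sn).
  by apply: eq_bigr => i _; rewrite indicE mem_set// mul1r.
apply: (bochner_L2_sum seminorm_norm) => // n.
apply: (bochner_L2_sum seminorm_norm) => // i.
apply: (bochner_L2_scale seminorm_norm mT (C := (`|0| + `|T|) ^+ i)) => //.
- exact: lebesgue_itv_fin.
- apply: measurable_funM; last by apply: measurable_funX; exact: measurable_id.
  by apply: measurable_indic; exact: measurable_itv.
- move=> s; rewrite /= in_itv/= => sJ.
  apply: le_trans (exprn_bound i sJ); rewrite normrM ler_piMl//.
  by rewrite indicE; case: (_ \in _); rewrite ?normr1 ?normr0.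
Qed.

End BrokenFunctions.

(** * A quadratic form of the triangle inequality *)

Section Young.
Context {R : realType}.

(** An inequality additive in [(x, p, z)], unlike the triangle inequality for square
roots that it encodes when it holds for all [e > 0]. *)
Definition young (e x p z : R) : Prop := x <= (1 + e) * p + (1 + e^-1) * z.

(** The difference of the two sides is [(e a - b)^2 / e]. *)
Lemma young_sqr (e a b : R) : 0 < e -> young e ((a + b) ^+ 2) (a ^+ 2) (b ^+ 2).
Proof.
move=> e0; rewrite /young -(ler_pM2l e0).
have -> : e * ((1 + e) * a ^+ 2 + (1 + e^-1) * b ^+ 2) =
    e * (a + b) ^+ 2 + (e * a - b) ^+ 2 by field; rewrite gt_eqF.
by rewrite lerDl sqr_ge0.
Qed.

Lemma youngD e x p z x' p' z' : young e x p z -> young e x' p' z' ->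
  young e (x + x') (p + p') (z + z').
Proof. by rewrite /young => h h'; lra. Qed.

Lemma youngZ e c x p z : 0 <= c -> young e x p z -> young e (c * x) (c * p) (c * z).
Proof.
by move=> c0 h; rewrite /young (le_trans (ler_wpM2l c0 h))// le_eqVlt; apply/orP; left; apply/eqP; ring.
Qed.

Lemma young_sum e (I : Type) (r : seq I) (P : pred I) (x p z : I -> R) :
  (forall i, P i -> young e (x i) (p i) (z i)) ->
  young e (\sum_(i <- r | P i) x i) (\sum_(i <- r | P i) p i) (\sum_(i <- r | P i) z i).
Proof.
move=> h; rewrite /young !mulr_sumr -big_split; exact: ler_sum.
Qed.

Lemma young_norm e (E : normedModType R) (x p z : E) : 0 < e -> x = p + z ->
  young e (`|x| ^+ 2) (`|p| ^+ 2) (`|z| ^+ 2).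
Proof.
move=> e0 ->; apply: le_trans (young_sqr _ _ e0).
by rewrite ler_sqr ?nnegrE ?addr_ge0// ler_normD.
Qed.

(** The best choice is [e = b / a], where [a] and [b] are the square roots of [p] and
[z]. Both are first increased by [d / 2], as they may vanish. *)
Lemma young_sqrt x p z : 0 <= p -> 0 <= z -> (forall e, 0 < e -> young e x p z) ->
  Num.sqrt x <= Num.sqrt p + Num.sqrt z.
Proof.
move=> p0 z0 h; apply/ler_addgt0Pr => d d0.
set a := Num.sqrt p; set b := Num.sqrt z.
have a0 : 0 <= a by exact: sqrtr_ge0.
have b0 : 0 <= b by exact: sqrtr_ge0.
have pa : p = a ^+ 2 by rewrite sqr_sqrtr.
have zb : z = b ^+ 2 by rewrite sqr_sqrtr.
pose a' := a + d / 2; pose b' := b + d / 2.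
have a'0 : 0 < a' by rewrite /a'; lra.
have b'0 : 0 < b' by rewrite /b'; lra.
have e0 : 0 < b' / a' by rewrite divr_gt0.
have -> : a + b + d = a' + b' by rewrite /a' /b'; field.
have ab0 : 0 <= a' + b' by rewrite ltW// addr_gt0.
rewrite -[leRHS](ger0_norm ab0) -sqrtr_sqr; apply: ler_wsqrtr.
apply: le_trans (h _ e0) _.
have -> : (a' + b') ^+ 2 = (1 + b' / a') * a' ^+ 2 + (1 + (b' / a')^-1) * b' ^+ 2.
  by field; rewrite !gt_eqF.
have i0 : 0 < (b' / a')^-1 by rewrite invr_gt0.
have aa' : a ^+ 2 <= a' ^+ 2.
  by rewrite ler_sqr ?nnegrE// ?(ltW a'0)// lerDl divr_ge0// ltW.
have bb' : b ^+ 2 <= b' ^+ 2.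
  by rewrite ler_sqr ?nnegrE// ?(ltW b'0)// lerDl divr_ge0// ltW.
by rewrite pa zb lerD// ler_wpM2l// addr_ge0// ltW.
Qed.

Lemma young_integral e (E : lmodType R) (S : set E) (nrm : E -> R) (D : set R)
    (x p z : R -> E) : seminorm_on S nrm -> measurable D -> 0 < e ->
  bochner_L2 S nrm D x -> bochner_L2 S nrm D p -> bochner_L2 S nrm D z ->
  (forall s, D s -> x s = p s + z s) ->
  young e (\int[lebesgue_measure]_(s in D) (nrm (x s) ^+ 2))
          (\int[lebesgue_measure]_(s in D) (nrm (p s) ^+ 2))
          (\int[lebesgue_measure]_(s in D) (nrm (z s) ^+ 2)).
Proof.
move=> sn mD e0 /(bochner_L2P sn mD)[_ xi] /(bochner_L2P sn mD)[[Sp _] pi]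
  /(bochner_L2P sn mD)[[Sz _] zi] xpz.
have ip : lebesgue_measure.-integrable D (EFin \o (fun s => (1 + e) * nrm (p s) ^+ 2)).
  exact: (@integrableZl _ _ R lebesgue_measure D mD (1 + e) _ pi).
have iz : lebesgue_measure.-integrable D (EFin \o (fun s => (1 + e^-1) * nrm (z s) ^+ 2)).
  exact: (@integrableZl _ _ R lebesgue_measure D mD (1 + e^-1) _ zi).
rewrite /young -!RintegralZl// -RintegralD//.
apply: le_Rintegral => //; first exact: (@integrableD _ _ R lebesgue_measure D mD _ _ ip iz).
move=> s Ds; rewrite xpz//; apply: le_trans (young_sqr _ _ e0).
have Sps := Sp _ Ds; have Szs := Sz _ Ds.
have n0 := seminorm_ge0 sn (sdomD sn Sps Szs).
have np := seminorm_ge0 sn Sps; have nz := seminorm_ge0 sn Szs.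
by rewrite ler_sqr ?nnegrE ?addr_ge0//; exact: (seminorm_leD sn).
Qed.

End Young.

(** * Additivity, consistency and stability of the form *)

Section Sums.
Context {R : realType} {V H : completeNormedModType R}.
Variables (ipH : {dot H for (@idfun R)}) (iota : {linear V -> H}).
Hypotheses (hH : hilbert ipH) (iota_cont : continuous iota).
Variables (T : R) (q N : nat) (t : nat -> R).
Hypotheses (hT : 0 < T) (ht : time_partition T N t).
Implicit Types (x p z w v : bfun V H) (f g h : R -> V).

Local Notation J n := (open_step t n).
Local Notation poly := (piecewise_poly q N t).
Local Notation bf := (bfun_of ipH iota).
Local Notation regular := (regular N t).

Lemma steps_gt0 : (0 < N)%N.
Proof.
have [t0 tN _] := ht; rewrite lt0n; apply/eqP => N0.
by move: hT; rewrite -tN N0 t0 ltxx.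
Qed.

(** The relation [x = p + z] as far as the form and the norms can see it: the
derivative of a piecewise polynomial is only compared inside the steps. *)
Definition is_sum x p z : Prop := forall n, (n < N)%N ->
  [/\ forall s, J n s -> valV x s = valV p s + valV z s,
      forall s, J n s -> der x s = der p s + der z s
    & forall s, Jn t n s -> valH x s = valH p s + valH z s].

Lemma is_sum_error u w : is_sum u (bfun_sub u w) w.
Proof.
by move=> n _; split=> s _ /=; rewrite ?subrK//; apply/funext => y /=; rewrite !fctE subrK.
Qed.

(** The splitting [u - g = (u - f) + (f - g)], whose last term is a discrete function
with its own derivative, not a formal difference of derivatives. *)
Lemma is_sum_errors u f g : poly f -> poly g ->
  is_sum (bfun_sub u (bf g)) (bfun_sub u (bf f)) (bf (fun s => f s - g s)).
Proof.
move=> pf pg n nN; have [a fa] := poly_piece pf nN; have [b gb] := poly_piece pg nN.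
split=> s sJ /=.
- by rewrite addrA subrK.
- have -> : derive1 (fun s => f s - g s) s = derive1 f s - derive1 g s.
    rewrite (poly_derive1 fa sJ) (poly_derive1 gb sJ).
    rewrite (@poly_derive1 _ _ _ _ _ _ (fun i => a i - b i) _ _ sJ); last first.
      move=> r rJ; rewrite fa// gb// -sumrB.
      by apply: eq_bigr => i _; rewrite scalerBr.
    by rewrite -sumrB; apply: eq_bigr => i _; rewrite scalerBr.
  apply/funext => y; rewrite !fctE linearB /=.
  by rewrite linearBl addrA subrK.
- by rewrite linearB addrA subrK.
Qed.

Section Traces.
Variables x p z : bfun V H.
Hypotheses (xpz : is_sum x p z) (rp : regular p) (rz : regular z).

Lemma rtraceD n : (n < N)%N -> rtrace t x n = rtrace t p n + rtrace t z n.
Proof.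
move=> nN; have [_ _ cp] := rp nN; have [_ _ cz] := rz nN.
apply/cvg_lim => //; apply: cvg_trans (cvgD cp cz); apply: near_eq_cvg.
apply: filterS (near_open_step ht nN) => s sJ.
by have [_ _ ->] := xpz nN; last exact: open_step_Jn.
Qed.

Lemma ltraceD n : (n < N)%N -> ltrace t x n.+1 = ltrace t p n.+1 + ltrace t z n.+1.
Proof.
move=> nN; have [_ _ e] := xpz nN; apply: e; rewrite /Jn /= in_itv /= lexx andbT.
by have [_ _ ->] := ht.
Qed.

Lemma jumpD n : (1 <= n < N)%N -> jump t x n = jump t p n + jump t z n.
Proof.
case: n => // n /andP[_ nN].
by rewrite /jump rtraceD// ltraceD ?(ltnW nN)// opprD addrACA.
Qed.

End Traces.

Section Bilinear.
Variables (A : R -> V -> V -> R) (alpha M : R).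
Hypothesis hA : admissible_operator T A alpha M.

Lemma form_integrable n w v : (n < N)%N -> regular w -> regular v ->
  ae_integrable lebesgue_measure (J n)
    (fun s => der w s (valV v s) + A s (valV w s) (valV v s)).
Proof.
move=> nN rw rv; have [Lw Lw' _] := rw _ nN; have [Lv _ _] := rv _ nN.
apply: ae_integrableD; first exact: measurable_open_step.
  by apply: integrable_ae; apply: duality_integrable => //; exact: measurable_open_step.
apply: (operator_ae_integrable hA) => //; first exact: measurable_open_step.
exact: (open_step_sub ht nN).
Qed.

(** The operator is additive only outside a null set, which the integrals do not see. *)
Lemma BtauD x p z v : is_sum x p z -> regular p -> regular z -> regular v ->
  Btau ipH A N t x v = Btau ipH A N t p v + Btau ipH A N t z v.
Proof.
move=> xpz rp rz rv; rewrite /Btau.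
have N0 := steps_gt0.
have -> : \sum_(n < N) \int[lebesgue_measure]_(s in Jn t n)
     (der x s (valV v s) + A s (valV x s) (valV v s)) =
  \sum_(n < N) \int[lebesgue_measure]_(s in Jn t n)
     (der p s (valV v s) + A s (valV p s) (valV v s)) +
  \sum_(n < N) \int[lebesgue_measure]_(s in Jn t n)
     (der z s (valV v s) + A s (valV z s) (valV v s)).
  rewrite -big_split; apply: eq_bigr => -[n nN] _ /=; rewrite !Rintegral_Jn.
  apply: ae_RintegralD; [exact: measurable_open_step|exact: form_integrable|exact: form_integrable|].
  have [Z [mZ Z0 ZA]] := operator_off_null hA.
  exists Z; split => // s nZs; split=> // sJ /=.
  have [_ AD _ _] := ZA _ nZs (open_step_sub ht nN sJ).
  have [-> // -> // _] := xpz _ nN; rewrite AD.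
  by rewrite !fctE; ring.
rewrite (rtraceD xpz)// linearDl.
have -> : \sum_(1 <= n < N) ipH (jump t x n) (rtrace t v n) =
  \sum_(1 <= n < N) ipH (jump t p n) (rtrace t v n) +
  \sum_(1 <= n < N) ipH (jump t z n) (rtrace t v n).
  rewrite -big_split; apply: eq_big_nat => n nN /=.
  by rewrite (jumpD xpz)// linearDl.
by ring.
Qed.

(** The jumps of [u] vanish by continuity, and its right limit at [0] is the initial
value; what remains is the weak equation tested with [f] and its initial trace. *)
Lemma Btau_consistent F u0 u f : solves_P ipH iota T A F u0 u -> poly f ->
  Btau ipH A N t u (bf f) =
  \int[lebesgue_measure]_(s in `]0, T[) F s (f s) + ipH u0 (rtrace t (bf f) 0%N).
Proof.
move=> [Xu Pu] pf; have Lf := L2V_Stau ht pf; rewrite -(Pu _ _ Lf).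
have [Lu Lu' _ _ _] := Xu; have [t0 _ _] := ht.
have ru k : (k < N)%N -> rtrace t u k = valH u (t k) := rtrace_Xspace ht Xu.
rewrite /Btau ru ?steps_gt0// t0 big_nat_cond [X in _ + X = _]big1 ?addr0; last first.
  move=> k /andP[/andP[_ kN] _].
  by rewrite /jump ru// /ltrace subrr ip0l.
congr (_ + _); rewrite (Rintegral_steps ht)//.
apply: ae_integrableD; first exact: measurable_itv.
  by apply: integrable_ae; apply: duality_integrable => //; exact: measurable_itv.
by apply: (operator_ae_integrable hA) => //; exact: measurable_itv.
Qed.

Lemma Btau_galerkin F u0 u f g : solves_P ipH iota T A F u0 u ->
  solves_DG ipH iota T A q N t F u0 (bf g) -> poly g -> poly f ->
  Btau ipH A N t (bfun_sub u (bf g)) (bf f) = 0.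
Proof.
move=> Pu [_ DGg] pg pf; have ru := regular_Xspace ht (proj1 Pu).
have rg := regular_Stau hH iota_cont ht pg.
have rf := regular_Stau hH iota_cont ht pf.
have := BtauD (is_sum_error u (bf g)) (regular_sub ru rg) rg rf.
rewrite (Btau_consistent Pu pf) (DGg (bf f)); last by exists f.
by move=> /eqP; rewrite eq_sym -subr_eq0 addrK => /eqP.
Qed.

End Bilinear.

Section Triangle.
Variables x p z : bfun V H.
Hypotheses (xpz : is_sum x p z).
Hypotheses (rx : regular x) (rp : regular p) (rz : regular z).

Lemma L2V_part_split w : L2V_part N t w =
  \sum_(n < N) \int[lebesgue_measure]_(s in J n) (`|valV w s| ^+ 2).
Proof. by apply: eq_bigr => n _; rewrite Rintegral_Jn. Qed.

Lemma energy_part_split w : regular w -> energy_part N t w =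
  \sum_(n < N) \int[lebesgue_measure]_(s in J n) (dual_norm (der w s) ^+ 2)
  + L2V_part N t w.
Proof.
move=> rw; rewrite L2V_part_split -big_split; apply: eq_bigr => -[n nN] _ /=.
have mJ : measurable (J n) by exact: measurable_open_step.
have [/(bochner_L2P seminorm_norm mJ)[_ Lw] /(bochner_L2P seminorm_dual mJ)[_ Lw'] _] := rw n nN.
by rewrite Rintegral_Jn RintegralD.
Qed.

Lemma young_L2V_part e : 0 < e ->
  young e (L2V_part N t x) (L2V_part N t p) (L2V_part N t z).
Proof.
move=> e0; rewrite !L2V_part_split; apply: young_sum => -[n nN] _ /=.
have [Lx _ _] := rx nN; have [Lp _ _] := rp nN; have [Lz _ _] := rz nN.
have [xv _ _] := xpz nN.
exact: (young_integral seminorm_norm (measurable_open_step t n) e0 Lx Lp Lz xv).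
Qed.

Lemma young_energy_part e : 0 < e ->
  young e (energy_part N t x) (energy_part N t p) (energy_part N t z).
Proof.
move=> e0; rewrite !energy_part_split//; apply: youngD; last exact: young_L2V_part.
apply: young_sum => -[n nN] _ /=.
have [_ Lx _] := rx nN; have [_ Lp _] := rp nN; have [_ Lz _] := rz nN.
have [_ xv _] := xpz nN.
exact: (young_integral seminorm_dual (measurable_open_step t n) e0 Lx Lp Lz xv).
Qed.

Lemma L2V_part_ge0 w : 0 <= L2V_part N t w.
Proof. by apply: sumr_ge0 => n _; apply: Rintegral_ge0 => s _; exact: sqr_ge0. Qed.

Lemma energy_part_ge0 w : 0 <= energy_part N t w.
Proof.
by apply: sumr_ge0 => n _; apply: Rintegral_ge0 => s _; rewrite addr_ge0 ?sqr_ge0.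
Qed.

Lemma step_ge0 n : (n < N)%N -> 0 <= step t n.
Proof. by move=> nN; rewrite /step subr_ge0 ltW//; have [_ _] := ht; apply. Qed.

Lemma norm_X_triangle : norm_X N t x <= norm_X N t p + norm_X N t z.
Proof.
have ge0 w : 0 <= energy_part N t w + `|rtrace t w 0%N| ^+ 2
    + \sum_(1 <= n < N) `|jump t w n| ^+ 2.
  by rewrite !addr_ge0 ?energy_part_ge0 ?sqr_ge0// sumr_ge0// => n _; exact: sqr_ge0.
apply: young_sqrt => // e e0; apply: youngD.
  apply: youngD; first exact: young_energy_part.
  by apply: young_norm => //; apply: rtraceD => //; exact: steps_gt0.
rewrite big_nat_cond [X in young e _ X]big_nat_cond [X in young e _ _ X]big_nat_cond.
by apply: young_sum => n /andP[nN _]; apply: young_norm => //; exact: jumpD.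
Qed.

Lemma tnorm_Ysharp_triangle :
  tnorm_Ysharp N t x <= tnorm_Ysharp N t p + tnorm_Ysharp N t z.
Proof.
have ge0 w : 0 <= L2V_part N t w + `|ltrace t w N| ^+ 2
    + \sum_(1 <= n < N) step t n * `|rtrace t w n| ^+ 2.
  rewrite !addr_ge0 ?L2V_part_ge0 ?sqr_ge0// big_nat_cond.
  by apply: sumr_ge0 => n /andP[/andP[_ nN] _]; rewrite mulr_ge0 ?sqr_ge0// step_ge0.
apply: young_sqrt => // e e0; apply: youngD.
  apply: youngD; first exact: young_L2V_part.
  apply: young_norm => //; rewrite -(prednK steps_gt0).
  by apply: ltraceD => //; rewrite prednK// steps_gt0.
rewrite big_nat_cond [X in young e _ X]big_nat_cond [X in young e _ _ X]big_nat_cond.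
apply: young_sum => n /andP[/andP[_ nN] _]; apply: youngZ; first exact: step_ge0.
by apply: young_norm => //; exact: rtraceD.
Qed.

End Triangle.

Lemma step_le1 n : mesh N t <= 1 -> (n < N)%N -> step t n <= 1.
Proof.
move=> m1 nN; apply: le_trans m1.
exact: (le_bigmax _ (fun n : 'I_N => step t n) (Ordinal nN)).
Qed.

(** The weights [1 / step] are at least 1. *)
Lemma norm_X_le_star w : mesh N t <= 1 -> norm_X N t w <= norm_Xstar N t w.
Proof.
move=> m1; apply: ler_wsqrtr; rewrite lerD2l; apply: ler_sum_nat => n /andP[_ nN].
have s0 : 0 < step t n by rewrite /step subr_gt0; have [_ _] := ht; apply.
by rewrite ler_peMl ?sqr_ge0// invf_ge1// step_le1.
Qed.

Lemma tnorm_Ysharp_le w : mesh N t <= 1 -> tnorm_Ysharp N t w <= tnorm_Y N t w.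
Proof.
move=> m1; apply: ler_wsqrtr; rewrite lerD2l; apply: ler_sum_nat => n /andP[_ nN].
by rewrite ler_piMl ?sqr_ge0// step_le1.
Qed.

Section Zero.
Variable f : R -> V.
Hypothesis f0 : forall s, 0 < s <= T -> f s = 0.

Lemma zero_Jn n s : (n < N)%N -> Jn t n s -> f s = 0.
Proof. by move=> nN sJ; apply: f0; exact: (Jn_ge0 ht nN sJ). Qed.

Lemma zero_L2V_part : L2V_part N t (bf f) = 0.
Proof.
apply: big1 => -[n nN] _ /=.
rewrite (@eq_Rintegral _ _ _ _ _ (fun=> 0)); last first.
  by move=> s /set_mem sJ; rewrite /= (zero_Jn nN sJ) normr0 expr0n.
by rewrite Rintegral_cst ?mul0r//; exact: measurable_itv.
Qed.

(** On each open step the function is the polynomial with no coefficient, so that its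
derivative vanishes there too. *)
Lemma zero_energy_part : energy_part N t (bf f) = 0.
Proof.
apply: big1 => -[n nN] _ /=.
rewrite Rintegral_Jn (@eq_Rintegral _ _ _ _ _ (fun=> 0)); last first.
  move=> s /set_mem sJ; rewrite /= (zero_Jn nN (open_step_Jn sJ)) normr0 expr0n addr0.
  have -> : derive1 f s = 0.
    rewrite (@derive1_vpoly _ _ 0 (fun=> 0) f (t n) (t n.+1) s).
    - by rewrite /dvpoly big_ord0.
    - move=> r rJ; rewrite /vpoly big_ord0; apply: (zero_Jn nN).
      by apply: open_step_Jn; rewrite /open_step/= in_itv.
    - by move: sJ; rewrite /open_step/= in_itv.
  rewrite (_ : (fun=> _) = (0 : V -> R)); last first.
    by apply/funext => y; rewrite linear0 ip0l.
  by rewrite (seminorm0 seminorm_dual) expr0n.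
by rewrite Rintegral_cst ?mul0r//; exact: measurable_itv.
Qed.

Lemma zero_rtrace n : (n < N)%N -> rtrace t (bf f) n = 0.
Proof.
move=> nN; apply/cvg_lim => //; apply: (cvg_trans (G := cst (0 : H) @ (t n)^'+)); last exact: cvg_cst.
apply: near_eq_cvg; apply: filterS (near_open_step ht nN) => s sJ /=.
by rewrite (zero_Jn nN (open_step_Jn sJ)) linear0.
Qed.

Lemma zero_ltrace n : (0 < n <= N)%N -> ltrace t (bf f) n = 0.
Proof.
case: n => // n /= nN; rewrite /ltrace /= (@zero_Jn n) ?linear0//.
rewrite /Jn /= in_itv/= lexx andbT.
by have [_ _ ->] := ht.
Qed.

Lemma zero_norm_X : norm_X N t (bf f) = 0.
Proof.
rewrite /norm_X zero_energy_part zero_rtrace ?steps_gt0// big_nat_cond big1.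
  by rewrite normr0 expr0n !addr0 sqrtr0.
move=> n /andP[/andP[n0 nN] _].
by rewrite /jump zero_rtrace// zero_ltrace ?n0 ?(ltnW nN)// subrr normr0 expr0n.
Qed.

Lemma zero_tnorm_Ysharp : tnorm_Ysharp N t (bf f) = 0.
Proof.
rewrite /tnorm_Ysharp zero_L2V_part zero_ltrace ?steps_gt0 ?leqnn// big_nat_cond big1.
  by rewrite normr0 expr0n !addr0 sqrtr0.
move=> n /andP[/andP[n0 nN] _].
by rewrite zero_rtrace// normr0 expr0n mulr0.
Qed.

End Zero.

Section InfSup.
Variables (A : R -> V -> V -> R).
Variables (nw nv : bfun V H -> R) (c K : R).

(** Discrete stability: an estimate of the functional [B z] on discrete functions
controls the norm of [z]. The functions vanishing on (0, T], over which the infimum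
does not range, are covered by the hypothesis that their norm is zero. *)
Lemma infsup_control f : infsup_constant ipH iota T A q N t nw nv c ->
  poly f -> 0 <= nw (bf f) -> (forall v, 0 <= nv v) -> 0 <= K ->
  ((forall s, 0 < s <= T -> f s = 0) -> nw (bf f) = 0) ->
  (forall h, poly h -> Btau ipH A N t (bf f) (bf h) <= K * nv (bf h)) ->
  c * nw (bf f) <= K.
Proof.
move=> [c0 cinf] pf; rewrite le_eqVlt => /predU1P[<-|n0] nv0 K0 z0 BK.
  by rewrite mulr0.
rewrite -ler_pdivlMr// -lee_fin (le_trans cinf)//.
apply: (@le_trans _ _ (ereal_sup [set (Btau ipH A N t (bf f) v / (nw (bf f) * nv v))%:E
   | v in Stau_nonzero ipH iota T q N t])).
  (* a function of positive norm is nonzero, hence competes in the infimum *)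
  apply: ereal_inf_lbound; exists (bf f) => //; split; first by exists f.
  apply: contrapT => h; have := z0; move: n0; rewrite lt_def => /andP[/eqP n0 _].
  move=> h'; apply: n0; apply: h' => s sT; apply: contrapT => fs.
  by apply: h; exists s => //; exact/eqP.
apply: ge_ereal_sup => _ [_ [[h ph <-] _] <-]; rewrite lee_fin.
have := nv0 (bf h); rewrite le_eqVlt => /predU1P[<-|v0].
  by rewrite mulr0 invr0 mulr0 divr_ge0// ltW.
rewrite ler_pdivrMr ?mulr_gt0// mulrA divfK ?gt_eqF//.
exact: BK.
Qed.

End InfSup.

End Sums.

(** * Quasi-optimality *)

Section QuasiOptimality.
Context {R : realType} {V H : completeNormedModType R}.
Variables (ipH : {dot H for (@idfun R)}) (iota : {linear V -> H}).
Hypotheses (hH : hilbert ipH) (iota_cont : continuous iota).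
Variables (T : R) (q N : nat) (t : nat -> R).
Hypotheses (hT : 0 < T) (ht : time_partition T N t).
Variables (A : R -> V -> V -> R) (alpha M : R).
Hypothesis hA : admissible_operator T A alpha M.
Variables (F : R -> V -> R) (u0 : H) (u utau : bfun V H).
Hypotheses (hu : solves_P ipH iota T A F u0 u)
  (hutau : solves_DG ipH iota T A q N t F u0 utau).

Local Notation S := (Stau ipH iota q N t).

(** Consistency, inf-sup stability and boundedness, for any triple of norms: the error
[u - utau] is split at an arbitrary discrete [w] into [u - w] and the discrete
function [w - utau], on which the form coincides with [- B (u - w)]. *)
Lemma quasi_optimal (nw nws nv : bfun V H -> R) (c K : R) :
  infsup_constant ipH iota T A q N t nw nv c ->
  boundedness_constant ipH iota A q N t u nws nv K ->
  (forall w, 0 <= nw w) -> (forall w, 0 <= nws w) -> (forall w, 0 <= nv w) ->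
  (forall w, nw w <= nws w) ->
  (forall x p z, is_sum N t x p z ->
     regular N t x -> regular N t p -> regular N t z -> nw x <= nw p + nw z) ->
  (forall f, (forall s, 0 < s <= T -> f s = 0) -> nw (bfun_of ipH iota f) = 0) ->
  nw (bfun_sub u utau) <= (1 + K / c) * inf [set nws (bfun_sub u w) | w in S].
Proof.
move=> hc [K0 hK] nw0 nws0 nv0 nw_le nwD nwz; have [c0 _] := hc.
have C0 : 0 < 1 + K / c by rewrite addr_gt0// divr_gt0.
rewrite -ler_pdivrMl//; apply: lb_le_inf.
  by exists (nws (bfun_sub u utau)); exists utau => //; case: hutau.
move=> _ [_ [f pf <-] <-]; rewrite ler_pdivrMl//.
have [[g pg gE] _] := hutau; rewrite -gE.
have hg : solves_DG ipH iota T A q N t F u0 (bfun_of ipH iota g) by rewrite gE.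
have ru := regular_Xspace ht (proj1 hu).
have reg h : piecewise_poly q N t h -> regular N t (bfun_of ipH iota h).
  exact: (regular_Stau hH iota_cont ht).
set z := bfun_of ipH iota (fun s => f s - g s).
have pz := poly_sub pf pg; have sum_z := is_sum_errors ipH iota u pf pg.
have rg := regular_sub ru (reg _ pg); have rf := regular_sub ru (reg _ pf).
have rz := reg _ pz.
(* the triangle inequality reduces the claim to the stability estimate for [z] *)
suff : c * nw z <= K * nws (bfun_sub u (bfun_of ipH iota f)).
  rewrite -ler_pdivlMl// mulrA [c^-1 * K]mulrC => zle.
  rewrite (le_trans (nwD _ _ _ sum_z rg rf rz))// mulrDl mul1r.
  by rewrite lerD.
apply: (infsup_control hc) => //; first by rewrite mulr_ge0// ltW.
  by move=> f0; apply: nwz.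
move=> h ph.
(* Galerkin orthogonality turns additivity into [B z v = - B (u - w) v] *)
have := BtauD ipH hT ht hA sum_z rf rz (reg _ ph).
rewrite (Btau_galerkin hH iota_cont hT ht hA hu hg pg ph) => /eqP.
rewrite eq_sym addr_eq0 => /eqP /(congr1 -%R); rewrite opprK => <-.
apply: le_trans (hK _ _ _ _); last by exists h.
  by rewrite -normrN ler_norm.
by right; exists (bfun_of ipH iota f) => //; exists f.
Qed.

End QuasiOptimality.

Theorem theorem4 (R : realType)
  (c1 c2 : R -> R -> nat -> R) (M1 M2 : R -> R)
  (V H : completeNormedModType R)
  (ipV : {dot V for (@idfun R)}) (ipH : {dot H for (@idfun R)})
  (hV : hilbert ipV) (hH : hilbert ipH)
  (iota : {linear V -> H}) (hiota : dense_injection iota)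
  (T : R) (hT : 0 < T)
  (A : R -> V -> V -> R) (alpha M : R)
  (hA : admissible_operator T A alpha M)
  (F : R -> V -> R) (hF : L2V' `]0, T[ F) (u0 : H)
  (q N : nat) (t : nat -> R) (ht : time_partition T N t) (hmesh : mesh N t <= 1)
  (u : bfun V H) (hu : solves_P ipH iota T A F u0 u)
  (utau : bfun V H) (hutau : solves_DG ipH iota T A q N t F u0 utau)
  (hc1 : infsup_constant ipH iota T A q N t
           (norm_X N t) (norm_Ysharp N t) (c1 alpha M q))
  (hc2 : infsup_constant ipH iota T A q N t
           (tnorm_Ysharp N t) (tnorm_X N t) (c2 alpha M q))
  (hM1 : boundedness_constant ipH iota A q N t u
           (norm_Xstar N t) (norm_Ysharp N t) (M1 M))
  (hM2 : boundedness_constant ipH iota A q N t u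
           (tnorm_Y N t) (tnorm_X N t) (M2 M)) :
  norm_X N t (bfun_sub u utau)
    <= (1 + M1 M / c1 alpha M q)
       * inf [set norm_Xstar N t (bfun_sub u w) | w in Stau ipH iota q N t]
  /\
  tnorm_Ysharp N t (bfun_sub u utau)
    <= (1 + M2 M / c2 alpha M q)
       * inf [set tnorm_Y N t (bfun_sub u w) | w in Stau ipH iota q N t].
Proof.
have [_ iota_cont _] := hiota.
split.
- apply: (quasi_optimal hH iota_cont hT ht hA hu hutau hc1 hM1);
    try by move=> w; exact: sqrtr_ge0.
  + by move=> w; exact: (norm_X_le_star ht).
  + by move=> x p z; exact: (norm_X_triangle hT ht).
  + by move=> f f0; exact: (zero_norm_X _ _ hT ht f0).
- apply: (quasi_optimal hH iota_cont hT ht hA hu hutau hc2 hM2);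
    try by move=> w; exact: sqrtr_ge0.
  + by move=> w; exact: tnorm_Ysharp_le.
  + by move=> x p z; exact: (tnorm_Ysharp_triangle hT ht).
  + by move=> f f0; exact: (zero_tnorm_Ysharp _ _ hT ht f0).
Qed.
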